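(* Let $A$ and $B$ be polynomially compact operators on a complex Banach space $X$. If $A[A,B]=[A,B]B=0$, then $A$ and $B$ are simultaneously triangularizable.
   Context: Operators on $X$ are bounded linear operators $X\to X$, and $[A,B]=AB-BA$. An operator $T$ is polynomially compact if there is a nonzero complex polynomial $p$ such that $p(T)$ is compact. $A$ and $B$ are simultaneously triangularizable if there is a chain (a set totally ordered by inclusion) of closed subspaces of $X$, each invariant under both $A$ and $B$, which is maximal as a chain in the lattice of all closed subspaces of $X$. *)

(* Defs.v *)
From mathcomp Require Import all_boot all_order all_algebra.
From mathcomp Require Import all_classical all_reals all_analysis.
From mathcomp Require Export complex.

Set Implicit Arguments.
Unset Strict Implicit.
Unset Printing Implicit Defensive.

Import Order.TTheory GRing.Theory Num.Theory.
Import numFieldNormedType.Exports.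

Local Open Scope classical_set_scope.
Local Open Scope ring_scope.

(* A complex Banach space is a [completeNormedModType R[i]] with R : realType.
   Its norm takes values in R[i]; these values are real because 0 <= `|x| forces
   a zero imaginary part. *)

Section Operators.
Variables (R : realType) (X : completeNormedModType R[i]).

(* By [linear_boundedP] this says that `|T x| <= r * `|x| for some r and all x;
   by [linear_bounded_continuous] it is the same as continuity. *)
Definition bounded_operator (T : {linear X -> X}) : Prop :=
  bounded_near T (nbhs (0 : X)).

Definition commutator (A B : X -> X) : X -> X := fun x => A (B x) - B (A x).

(* p(T).  The endomorphisms of X carry no ring structure in the library, so
   that [horner] does not apply. *)
Definition poly_operator (p : {poly R[i]}) (T : X -> X) : X -> X :=
  fun x => \sum_(i < size p) p`_i *: iter i T x.

Definition compact_operator (T : X -> X) : Prop :=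
  precompact (T @` [set x : X | `|x| <= 1]).

Definition polynomially_compact (T : X -> X) : Prop :=
  exists2 p : {poly R[i]}, p != 0 & compact_operator (poly_operator p T).

Definition closed_subspace (M : set X) : Prop :=
  submod_closed (mem M) /\ closed M.

Definition invariant_subspace (T : X -> X) (M : set X) : Prop :=
  T @` M `<=` M.

Definition subspace_chain (C : set (set X)) : Prop :=
  C `<=` closed_subspace /\ total_on C subset.

(* The maximality is among all chains of closed subspaces, not only among those
   whose members are invariant under some operator. *)
Definition maximal_subspace_chain (C : set (set X)) : Prop :=
  subspace_chain C /\
  forall D : set (set X), subspace_chain D -> C `<=` D -> D `<=` C.

Definition simultaneously_triangularizable (A B : X -> X) : Prop :=
  exists2 C : set (set X), maximal_subspace_chain C &
    forall M, C M -> invariant_subspace A M /\ invariant_subspace B M.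

End Operators.

(* Main.v *)
Require Import Defs.
From HB Require Import structures.
From mathcomp Require Import all_boot all_order all_algebra.
From mathcomp Require Import all_classical all_reals all_analysis.
From mathcomp Require Import ring lra.

(** The condition [A [A, B] = 0 = [A, B] B] says exactly that [S = AB] commutes
    with [A] and with [B].

    Take a maximal chain of closed subspaces invariant under both operators.  It
    is maximal among all chains of closed subspaces as soon as, for every pair of
    members [N] and [M] that encloses a further subspace [L] comparable with the
    chain, [A] and [B] act on [M / N] as scalars: then [L] is invariant too.  By
    maximality the action on [M / N] is irreducible, so everything reduces to
    this: an irreducible pair of polynomially compact operators with [S] central
    consists of scalars ([irreducible_pair_scalar]).  The quotient [M / N] is
    represented by [M] with the seminorm [p x = dist (x, N)], vectors with
    [p x = 0] being called null.

    Suppose first that [C = AB - BA] is not null ([irreducible_commutator_null]).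
    Since [AC = 0], the kernel of [A] is not null, and by Schur's lemma [S] is
    injective.  If [P(A)] is compact with [P = Q * 'X^k] and [Q(0) != 0], then
    [P(A) B^k = Q(A) S^k] is compact and equals [Q(0) S^k] on the kernel of [A].
    There Hilden's proof of Lomonosov's theorem gives an eigenvector of [S^k],
    hence one of [S], and by Schur's lemma [S] is a nonzero scalar.  But then
    [B^n] maps kernel vectors of [A] to vectors killed by [A^(n+1)] and not by
    [A^n], and the compact operator [Q(A)] acts as the nonzero scalar [Q(0)] on
    each quotient of successive kernels: this contradicts Riesz's lemma.

    If [A] and [B] commute ([commuting_irreducible_scalar]), the compact operator
    [P(A)] commutes with both and Hilden's argument applies to it directly; a
    commuting operator with an eigenvector is a scalar by Schur's lemma.

    Hilden's argument needs the alternative that a compact operator [K] has a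
    nonzero eigenvalue or small iterates.  If there is no such eigenvalue,
    [1 - mu K] is bounded below uniformly on every disc, by compactness.  The
    identity [1 / (1 - a) + 1 / (1 + a) = 2 / (1 - a ^ 2)] transfers the Lipschitz
    continuity of the resolvent from [K] to all powers [K ^ (2 ^ k)] with the same
    constant ([resolvent_doubling]), and this lets the inequality
    [p ((t K) ^ (2 ^ k) x) <= p x], for large [k], spread from [t] to
    [t + delta] with a fixed [delta]. *)

Set Implicit Arguments.
Unset Strict Implicit.
Unset Printing Implicit Defensive.

Import Order.TTheory GRing.Theory Num.Theory.
Import numFieldNormedType.Exports.

Local Open Scope classical_set_scope.
Local Open Scope ring_scope.

(** * Real-valued norms and polynomials in an operator *)

Section RealNorm.
Variable R : realType.

(** A norm over [R[i]] takes its values in [R[i]], which is only partially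
    ordered; the real part brings back the total order of [R], for vectors and
    for scalars alike. *)
Definition rnorm (V : normedZmodType R[i]) (x : V) : R := complex.Re `|x|.

Section Normed.
Variable V : normedZmodType R[i].
Implicit Types x y : V.

Lemma rnormE x : (rnorm x)%:C%C = `|x|.
Proof. by rewrite /rnorm RRe_real ?normr_real. Qed.

Lemma rnorm0 : rnorm (0 : V) = 0.
Proof. by rewrite /rnorm normr0. Qed.

Lemma rnormN x : rnorm (- x) = rnorm x.
Proof. by rewrite /rnorm normrN. Qed.

Lemma rnormBC x y : rnorm (x - y) = rnorm (y - x).
Proof. by rewrite -rnormN opprB. Qed.

Lemma rnorm_ge0 x : 0 <= rnorm x.
Proof. by rewrite -lecR rnormE normr_ge0. Qed.

Lemma rnormD x y : rnorm (x + y) <= rnorm x + rnorm y.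
Proof. by rewrite -lecR rmorphD /= !rnormE ler_normD. Qed.

Lemma rnorm_eq0 x : rnorm x = 0 -> x = 0.
Proof. by move=> e; apply/eqP; rewrite -normr_eq0 -rnormE e. Qed.
End Normed.

Lemma rnormM (a b : R[i]) : rnorm (a * b) = rnorm a * rnorm b.
Proof. by apply: complexI; rewrite rmorphM /= !rnormE normrM. Qed.

Lemma rnorm1 : rnorm (1 : R[i]) = 1.
Proof. by rewrite /rnorm normr1. Qed.

Lemma rnormV (a : R[i]) : rnorm a^-1 = (rnorm a)^-1.
Proof. by apply: complexI; rewrite fmorphV /= !rnormE normfV. Qed.

Lemma rnormX (a : R[i]) n : rnorm (a ^+ n) = rnorm a ^+ n.
Proof. by elim: n => [|n IH]; rewrite ?rnorm1 // !exprS rnormM IH. Qed.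

Lemma rnorm_real (r : R) : 0 <= r -> rnorm (r%:C%C : R[i]) = r.
Proof. by move=> r0; apply: complexI; rewrite rnormE ger0_norm ?lecR. Qed.

Lemma rnorm_gt0 (a : R[i]) : a != 0 -> 0 < rnorm a.
Proof.
by move=> a0; rewrite lt_def rnorm_ge0 andbT; apply: contra a0 => /eqP/rnorm_eq0 ->.
Qed.

Lemma rnormZ (V : normedModType R[i]) (a : R[i]) (x : V) :
  rnorm (a *: x) = rnorm a * rnorm x.
Proof. by apply: complexI; rewrite rmorphM /= !rnormE normrZ. Qed.

Lemma rnorm_le_ReIm (a : R[i]) :
  rnorm a <= `|complex.Re a| + `|complex.Im a|.
Proof.
case: a => u v; rewrite /rnorm normc_def /=.
rewrite -(@ler_pXn2r _ 2) ?nnegrE ?addr_ge0 ?sqrtr_ge0 //.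
rewrite sqr_sqrtr ?addr_ge0 ?sqr_ge0 // sqrrD !real_normK ?num_real //.
by have := mulr_ge0 (normr_ge0 u) (normr_ge0 v); lra.
Qed.

Lemma Re_le_rnorm (a : R[i]) : `|complex.Re a| <= rnorm a.
Proof. by rewrite -lecR rnormE normc_ge_Re. Qed.

Lemma Im_le_rnorm (a : R[i]) : `|complex.Im a| <= rnorm a.
Proof.
case: a => u v; rewrite /rnorm normc_def /= -sqrtr_sqr ler_wsqrtr //.
by rewrite lerDr sqr_ge0.
Qed.
End RealNorm.

Section PolyAction.
Variables (F : fieldType) (V : lmodType F) (T : {linear V -> V}).
Implicit Types (P Q : {poly F}) (x y : V).

(** The operator [P(T)].  Identities between polynomials in one operator are
    proved in the commutative ring [{poly F}] and transported by [polyopM]. *)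
Definition polyop P x : V := \sum_(i < size P) P`_i *: iter i T x.

Lemma polyop_wide P x n : (size P <= n)%N ->
  polyop P x = \sum_(i < n) P`_i *: iter i T x.
Proof.
move=> le; rewrite /polyop (big_ord_widen n (fun i => P`_i *: iter i T x)) //.
rewrite big_mkcond /=; apply: eq_bigr => i _; case: ltnP => // /(nth_default 0) ->.
by rewrite scale0r.
Qed.

Lemma polyopD P Q x : polyop (P + Q) x = polyop P x + polyop Q x.
Proof.
set n := maxn (size P) (size Q).
rewrite (@polyop_wide _ _ n) ?size_polyD // (@polyop_wide P _ n) ?leq_maxl //.
rewrite (@polyop_wide Q _ n) ?leq_maxr // -big_split /=.
by apply: eq_bigr => i _; rewrite coefD scalerDl.
Qed.

Lemma polyopZ a P x : polyop (a *: P) x = a *: polyop P x.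
Proof.
rewrite (@polyop_wide _ _ (size P)) ?size_scale_leq // scaler_sumr.
by apply: eq_bigr => i _; rewrite coefZ scalerA.
Qed.

Lemma iter_linear n : linear (iter n T).
Proof. by elim: n => [|n IH] a x y //=; rewrite IH linearP. Qed.

Lemma polyop_linear P : linear (polyop P).
Proof.
move=> a x y; rewrite scaler_sumr -big_split /=; apply: eq_bigr => i _.
by rewrite iter_linear scalerDr !scalerA mulrC.
Qed.

HB.instance Definition _ P :=
  GRing.isLinear.Build F V V *:%R (polyop P) (polyop_linear P).

Lemma polyop0 x : polyop 0 x = 0.
Proof. by rewrite /polyop size_poly0 big_ord0. Qed.

Lemma polyop1 x : polyop 1 x = x.
Proof. by rewrite /polyop size_poly1 big_ord1 coef1 scale1r. Qed.

Lemma polyopC a x : polyop a%:P x = a *: x.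
Proof. by rewrite -alg_polyC polyopZ polyop1. Qed.

Lemma polyopN P x : polyop (- P) x = - polyop P x.
Proof. by rewrite -[- P]scaleN1r polyopZ scaleN1r. Qed.

Lemma polyopB P Q x : polyop (P - Q) x = polyop P x - polyop Q x.
Proof. by rewrite polyopD polyopN. Qed.

Lemma polyopMX P x : polyop (P * 'X) x = polyop P (T x).
Proof.
rewrite (@polyop_wide _ _ (size P).+1); last first.
  by rewrite (leq_trans (size_polyMleq _ _)) // size_polyX addn2.
rewrite big_ord_recl coefMX /= scale0r add0r.
by apply: eq_bigr => i _; rewrite coefMX /= -iterSr.
Qed.

Lemma polyopM P Q x : polyop (P * Q) x = polyop P (polyop Q x).
Proof.
elim/poly_ind: Q P x => [|Q c IH] P x; first by rewrite mulr0 !polyop0 linear0.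
rewrite mulrDr polyopD mulrA polyopMX IH [in RHS]polyopD polyopMX linearD /=.
by rewrite [P * _]mulrC mul_polyC polyopZ polyopC linearZ.
Qed.

Lemma polyopX x : polyop 'X x = T x.
Proof. by rewrite -(mul1r 'X) polyopMX polyop1. Qed.

Lemma polyopXn n x : polyop 'X^n x = iter n T x.
Proof.
by elim: n x => [|n IH] x; rewrite ?polyop1 // exprSr polyopMX IH -iterSr.
Qed.

Lemma polyop_comm P x : polyop P (T x) = T (polyop P x).
Proof. by rewrite -!(polyopX x) -polyopM mulrC polyopM !polyopX. Qed.
End PolyAction.

(** * Seminorms, and the doubling identity for resolvents *)

Section Seminormed.
Variables (R : realType) (V : lmodType R[i]) (p : V -> R).
Implicit Types (x y : V) (M E : set V) (T K : {linear V -> V}).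

Record seminorm : Prop := Seminorm {
  sn_triangle : forall x y, p (x + y) <= p x + p y;
  sn_scale : forall a x, p (a *: x) = rnorm a * p x }.

Definition subspace M : Prop :=
  M 0 /\ forall a x y, M x -> M y -> M (a *: x + y).

Definition stable M (T : V -> V) : Prop := forall x, M x -> M (T x).

Definition sn_bounded (T : V -> V) : Prop :=
  exists2 c, 0 <= c & forall x, p (T x) <= c * p x.

Definition sn_converges (U : set_system nat) (u : nat -> V) y : Prop :=
  forall e, 0 < e -> U [set n | p (u n - y) < e].

(** Compactness is phrased along ultrafilters rather than subsequences: two
    limits can then be taken simultaneously without extracting twice. *)
Definition compact_on M (K : V -> V) : Prop :=
  forall (U : set_system nat) (u : nat -> V) c, UltraFilter U ->
    (forall n, M (u n)) -> (forall n, p (u n) <= c) ->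
    exists2 y, M y & sn_converges U (fun n => K (u n)) y.

Definition sn_closed_in M E : Prop :=
  forall x, M x -> (forall e, 0 < e -> exists2 y, E y & p (x - y) < e) -> E x.

Section Subspace.
Variables (M : set V) (sM : subspace M).

Lemma subspace0 : M 0. Proof. by case: sM. Qed.

Lemma subspaceP a x y : M x -> M y -> M (a *: x + y).
Proof. by case: sM => _; apply. Qed.

Lemma subspaceZ a x : M x -> M (a *: x).
Proof. by move=> Mx; rewrite -[_ *: _]addr0; apply: subspaceP => //; exact: subspace0. Qed.

Lemma subspaceD x y : M x -> M y -> M (x + y).
Proof. by move=> Mx My; rewrite -[x]scale1r; exact: subspaceP. Qed.

Lemma subspaceN x : M x -> M (- x).
Proof. by move=> Mx; rewrite -scaleN1r; exact: subspaceZ. Qed.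

Lemma subspaceB x y : M x -> M y -> M (x - y).
Proof. by move=> Mx My; apply: subspaceD => //; exact: subspaceN. Qed.

Lemma stable_iter T n : stable M T -> stable M (iter n T).
Proof. by move=> sT; elim: n => [|n IH] x Mx //=; apply/sT/IH. Qed.

Lemma stable_polyop T P : stable M T -> stable M (polyop T P).
Proof.
move=> sT x Mx; rewrite /polyop; elim/big_rec: _ => [|i y _ My]; first exact: subspace0.
by apply: subspaceP => //; exact: stable_iter.
Qed.
End Subspace.

Hypothesis snp : seminorm.

Lemma sn0 : p 0 = 0.
Proof. by rewrite -(scale0r (0 : V)) sn_scale // rnorm0 mul0r. Qed.

Lemma snN x : p (- x) = p x.
Proof. by rewrite -scaleN1r sn_scale // rnormN rnorm1 mul1r. Qed.

Lemma snBC x y : p (x - y) = p (y - x).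
Proof. by rewrite -snN opprB. Qed.

Lemma snB x y : p (x - y) <= p x + p y.
Proof. by rewrite -(snN y) sn_triangle. Qed.

Lemma sn_ge0 x : 0 <= p x.
Proof. by have := snB x x; rewrite subrr sn0; lra. Qed.

Lemma sn_sub x y : p x <= p (x - y) + p y.
Proof. by rewrite -{1}(subrK y x) sn_triangle. Qed.

Lemma sn_chain y x z : p (x - z) <= p (x - y) + p (y - z).
Proof. by rewrite -(subrK y x) addrK -addrA sn_triangle. Qed.

Lemma sn_eq x y : p (x - y) = 0 -> p x = p y.
Proof. by move=> e; have := sn_sub x y; have := sn_sub y x; rewrite snBC e; lra. Qed.

Lemma sn_gt0 x : p x <> 0 -> 0 < p x.
Proof. by move/eqP => n0; rewrite lt_def n0 sn_ge0. Qed.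

Lemma sn_small x : (forall e, 0 < e -> p x <= e) -> p x = 0.
Proof.
move=> H; apply/eqP; rewrite eq_le sn_ge0 andbT; apply/ler_addgt0Pr => e e0.
by rewrite add0r H.
Qed.

Lemma sn_bounded_null (T : V -> V) x : sn_bounded T -> p x = 0 -> p (T x) = 0.
Proof.
by move=> [c _ bT] x0; have := bT x; have := sn_ge0 (T x); rewrite x0 mulr0; lra.
Qed.

Lemma sn_bounded_eq T x y : sn_bounded T -> p (x - y) = 0 -> p (T x - T y) = 0.
Proof. by move=> bT e; rewrite -linearB; exact: sn_bounded_null. Qed.

Lemma sn_bounded_comp (S T : V -> V) :
  sn_bounded S -> sn_bounded T -> sn_bounded (S \o T).
Proof.
move=> [c c0 bS] [d d0 bT]; exists (c * d); first exact: mulr_ge0.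
move=> x /=; apply: le_trans (bS _) _.
by rewrite -mulrA; apply: ler_wpM2l => //.
Qed.

Lemma sn_bounded_id : sn_bounded id.
Proof. by exists 1 => // x; rewrite mul1r. Qed.

Lemma sn_bounded_iter (T : V -> V) n : sn_bounded T -> sn_bounded (iter n T).
Proof.
move=> bT; elim: n => [|n IH]; first exact: sn_bounded_id.
by have [c c0 H] := sn_bounded_comp bT IH; exists c.
Qed.

Lemma sn_bounded_lin (S T : V -> V) a :
  sn_bounded S -> sn_bounded T -> sn_bounded (fun x => a *: S x + T x).
Proof.
move=> [c c0 bS] [d d0 bT]; exists (rnorm a * c + d).
  by rewrite addr_ge0 ?mulr_ge0 ?rnorm_ge0.
move=> x; apply: le_trans (sn_triangle snp _ _) _; rewrite sn_scale // mulrDl.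
by rewrite lerD // -mulrA ler_wpM2l ?rnorm_ge0.
Qed.

Lemma sn_bounded_polyop T P : sn_bounded T -> sn_bounded (polyop T P).
Proof.
move=> bT; rewrite /polyop.
elim: (size P) => [|n [c c0 IH]].
  by exists 0 => // x; rewrite big_ord0 sn0 mul0r.
have [d d0 bd] := sn_bounded_iter n bT.
exists (c + rnorm P`_n * d); first by rewrite addr_ge0 ?mulr_ge0 ?rnorm_ge0.
move=> x; rewrite big_ord_recr /=; apply: le_trans (sn_triangle snp _ _) _.
by rewrite sn_scale // mulrDl lerD // -mulrA ler_wpM2l ?rnorm_ge0.
Qed.

(** The doubling step rests on
    [(a - b) (1 + a) (1 + b) - (a - b) (1 - a) (1 - b) = 2 (a ^ 2 - b ^ 2)],
    that is on [1 / (1 - a) + 1 / (1 + a) = 2 / (1 - a ^ 2)].  The constant [L]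
    survives because the hypothesis is rotation invariant. *)
Lemma resolvent_doubling E K (mu nu : R[i]) L :
  subspace E -> stable E K ->
  (forall z x, rnorm z = 1 -> E x -> rnorm (mu - nu) * p (K x) <=
     L * p (polyop K ((1 - (z * mu)%:P * 'X) * (1 - (z * nu)%:P * 'X)) x)) ->
  forall k (N := (2 ^ k)%N) z x, rnorm z = 1 -> E x ->
    p (polyop K ((mu ^+ N - nu ^+ N)%:P * 'X^N) x) <=
    L * p (polyop K ((1 - (z * mu ^+ N)%:P * 'X^N) *
                     (1 - (z * nu ^+ N)%:P * 'X^N)) x).
Proof.
move=> sE sK H k; elim: k => [|k IH] N z x z1 Ex.
  by rewrite /N expn0 !expr1 polyopM polyopX polyopC sn_scale // H.
have -> : N = (2 ^ k * 2)%N by rewrite /N expnSr.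
move: (2 ^ k)%N IH => {}N IH.
(* The hypothesis is used at both square roots [xi] and [- xi] of [z]. *)
have [xi xi2] : exists xi : R[i], xi ^+ 2 = z by exists (sqrtc z); rewrite sqr_sqrtc.
have xi1 : rnorm xi = 1.
  apply/eqP; rewrite -(@eqrXn2 _ 2) ?rnorm_ge0 //.
  by rewrite -rnormX xi2 z1 expr1n.
rewrite !exprM -xi2.
set m := mu ^+ N in IH *; set n := nu ^+ N in IH *; set X : {poly R[i]} := 'X^N in IH *.
set D := (m - n)%:P * X in IH.
pose zp := polyop K ((1 + (xi * m)%:P * X) * (1 + (xi * n)%:P * X)) x.
pose zm := polyop K ((1 - (xi * m)%:P * X) * (1 - (xi * n)%:P * X)) x.
have Ezp : E zp by exact: stable_polyop.
have Ezm : E zm by exact: stable_polyop.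
have Hp := IH xi zp xi1 Ezp.
have Hm := IH (- xi) zm (etrans (rnormN _) xi1) Ezm.
set G := (X in L * p X).
have eGp : polyop K ((1 - (xi * m)%:P * X) * (1 - (xi * n)%:P * X)) zp = G.
  by rewrite /zp /G -polyopM; congr (polyop _ _ _); rewrite !polyCM; ring.
have eGm : polyop K ((1 - (- xi * m)%:P * X) * (1 - (- xi * n)%:P * X)) zm = G.
  by rewrite /zm /G -polyopM; congr (polyop _ _ _); rewrite !(polyCM, polyCN); ring.
rewrite eGp in Hp; rewrite eGm in Hm.
have e2 : (2 * xi) *: polyop K ((m ^+ 2 - n ^+ 2)%:P * X ^+ 2) x =
          polyop K D zp - polyop K D zm.
  rewrite -(polyopC K) /zp /zm -!polyopM -polyopB; congr (polyop _ _ _).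
  by rewrite /D !(polyCM, polyCB, polyCN); ring.
have := snB (polyop K D zp) (polyop K D zm).
rewrite -e2 sn_scale // rnormM xi1 mulr1.
have -> : rnorm (2 : R[i]) = 2 by rewrite /rnorm normr_nat raddfMn.
lra.
Qed.
End Seminormed.

(** * Iterates of an operator whose resolvent is bounded on a disc *)

Section Growth.
Variables (R : realType) (V : lmodType R[i]) (p : V -> R).
Hypothesis snp : seminorm p.
Implicit Types (x y : V) (M E : set V) (T K : {linear V -> V}).

Lemma eventually_double_le (s t : R) : 0 <= s -> s < t ->
  exists k0, forall k, (k0 <= k)%N -> 2 * s ^+ (2 ^ k) <= t ^+ (2 ^ k).
Proof.
move=> s0 st; have t0 : 0 < t by lra.
have q1 : `|s / t| < 1.
  by rewrite ger0_norm ?divr_ge0 ?(ltW t0) // ltr_pdivrMr // mul1r.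
have /cvgrPdist_lt/(_ (1/2)) := cvg_expr q1.
case=> [|n0 _ H]; first by lra.
exists n0 => k le; have /= := H (2 ^ k)%N (leq_trans le (ltnW (ltn_expl k (isT : (1 < 2)%N)))).
rewrite sub0r normrN ger0_norm; last by rewrite exprn_ge0 // divr_ge0 // ltW.
by rewrite expr_div_n ltr_pdivrMr ?exprn_gt0 //; lra.
Qed.

Lemma polyop_1sub K a n x :
  polyop K (1 - a%:P * 'X^n) x = x - a *: iter n K x.
Proof. by rewrite polyopB polyop1 polyopM polyopC polyopXn. Qed.

Definition dyadic_bound E (K : V -> V) (t : R) : Prop :=
  exists k0, forall k x, (k0 <= k)%N -> E x ->
    t ^+ (2 ^ k) * p (iter (2 ^ k) K x) <= p x.

Definition disc_bound E (K : V -> V) (c r : R) : Prop :=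
  forall mu x, rnorm mu <= r -> E x -> c * p x <= p (x - mu *: K x).

(** With [H = (t' K) ^ N] and [h H = (t K) ^ N], the doubling lemma gives
    [(1 - h) p (H x) <= p ((1 - H) (1 - h H) x) / 8]; for large [N] the number
    [h] is below [1 / 2] and [h H] is a contraction, hence so is [H]. *)
Lemma dyadic_bound_step E K b c r t t' :
  subspace E -> stable E K -> (forall x, p (K x) <= b * p x) ->
  0 < c -> disc_bound E K c r ->
  0 <= t -> t < t' -> t' <= r -> 8 * ((t' - t) * b) <= c ^+ 2 ->
  dyadic_bound E K t -> dyadic_bound E K t'.
Proof.
move=> sE sK bK c0 low t0 tt' t'r small [k1 Hk1].
have [k2 Hk2] := eventually_double_le t0 tt'.
exists (maxn k1 k2) => k x; rewrite geq_max => /andP[le1 le2] Ex.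
have rt : rnorm (t'%:C%C - t%:C%C : R[i]) = t' - t.
  by rewrite -rmorphB /= rnorm_real // subr_ge0 ltW.
(* The resolvent identity, with the constant [1 / 8] coming from [small]. *)
have base z y : rnorm z = 1 -> E y -> rnorm (t'%:C%C - t%:C%C : R[i]) * p (K y) <=
    1 / 8 * p (polyop K ((1 - (z * t'%:C%C)%:P * 'X) * (1 - (z * t%:C%C)%:P * 'X)) y).
  move=> z1 Ey; rewrite -['X]expr1 polyopM !polyop_1sub /= rt.
  set w := y - _ *: K y.
  have Ew : E w.
    by apply: (subspaceB sE) => //; apply: (subspaceZ sE); apply: sK.
  have l1 : c * p w <= p (w - (z * t'%:C%C) *: K w).
    by apply: low => //; rewrite rnormM z1 mul1r rnorm_real //; lra.
  have l2 : c * p y <= p w.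
    by apply: low => //; rewrite rnormM z1 mul1r rnorm_real //; lra.
  have l3 : c * (c * p y) <= c * p w by rewrite ler_pM2l.
  have l4 : (t' - t) * p (K y) <= (t' - t) * (b * p y) by rewrite ler_pM2l ?subr_gt0.
  have l5 : 8 * ((t' - t) * b) * p y <= c ^+ 2 * p y by rewrite ler_wpM2r ?sn_ge0.
  by rewrite expr2 in l5; lra.
have := resolvent_doubling snp sE sK base k (rnorm1 R) Ex.
have := Hk2 k le2; have := Hk1 k ^~ le1; move: (2 ^ k)%N => N Hk HN.
rewrite !mul1r -!rmorphXn /= [X in p X <= _]polyopM polyopXn polyopC sn_scale //.
rewrite -rmorphB /= rnorm_real; last first.
  by have := exprn_ge0 N t0; lra.
rewrite [(1 - _) * _]mulrC polyopM !polyop_1sub.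
set w := x - _ *: _.
have Ew : E w.
  by apply: (subspaceB sE) => //; apply: (subspaceZ sE); apply: (stable_iter N sK).
have t'N : 0 <= t' ^+ N by apply: exprn_ge0; lra.
have tN : 0 <= t ^+ N by apply: exprn_ge0.
have := Hk w Ew.
have := snB snp w ((t ^+ N)%:C%C *: iter N K w).
have := snB snp x ((t' ^+ N)%:C%C *: iter N K x).
rewrite -/w !sn_scale // !rnorm_real //.
have : 2 * t ^+ N * p (iter N K x) <= t' ^+ N * p (iter N K x).
  by rewrite ler_wpM2r ?sn_ge0.
by lra.
Qed.

(** This stands in for the spectral radius formula.  The bound is trivial at
    [t = 0] and climbs to [t = r] in equal steps, whose admissible length depends
    only on [c] and on the norm of [K]. *)
Lemma dyadic_bound_disc E K c r :
  subspace E -> stable E K -> sn_bounded p K ->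
  0 <= r -> 0 < c -> disc_bound E K c r -> dyadic_bound E K r.
Proof.
move=> sE sK [b b0 bK] r0 c0 low.
have [m Hm] : exists m : nat, 8 * r * b < c ^+ 2 * m.+1%:R.
  have cc : 0 < c ^+ 2 by rewrite exprn_gt0.
  exists (Num.bound (8 * r * b / c ^+ 2)).
  rewrite [c ^+ 2 * _]mulrC -ltr_pdivrMr //; apply: lt_le_trans (archi_boundP _) _.
    by apply: divr_ge0; [do 2?[apply: mulr_ge0 => //] | exact: ltW].
  by rewrite ler_nat.
have [->|rn0] := eqVneq r 0.
  by exists 0 => k x _ _; rewrite expr0n expn_eq0 /= mul0r sn_ge0.
have rp : 0 < r by rewrite lt_def rn0.
pose d := r / m.+1%:R.
have d0 : 0 < d by rewrite divr_gt0.
have md : m.+1%:R * d = r by rewrite /d mulrC divfK ?pnatr_eq0.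
suff H j : (j <= m.+1)%N -> dyadic_bound E K (j%:R * d) by have := H _ (leqnn _); rewrite md.
elim: j => [|j IH] jm.
  by exists 0 => k x _ _; rewrite mul0r expr0n expn_eq0 /= mul0r sn_ge0.
have jd : 0 <= j%:R * d by apply: mulr_ge0 => //; exact: ltW.
have e : j.+1%:R * d = j%:R * d + d by rewrite -natr1 mulrDl mul1r.
apply: (@dyadic_bound_step E K b c r (j%:R * d)) => //; last exact: IH (ltnW jm).
- by rewrite e; lra.
- by rewrite -md ler_pM2r // ler_nat.
- rewrite e [_ + d]addrC addrK -(ler_pM2r (ltr0Sn R m)).
  by apply/ltW; apply: le_lt_trans Hm; rewrite -md; lra.
Qed.
End Growth.

(** * Compact operators: eigenvectors or small iterates *)

Section Compactness.
Variables (R : realType) (V : lmodType R[i]) (p : V -> R).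
Hypothesis snp : seminorm p.
Implicit Types (x y : V) (M E : set V) (T K F : {linear V -> V}).

Lemma le_of_arbitrarily_small (a b c : R) : 0 <= c ->
  (forall e, 0 < e -> a <= b + c * e) -> a <= b.
Proof.
move=> c0 H; apply/ler_addgt0Pr => e e0.
have c1 : 0 < c + 1 by lra.
apply: le_trans (H (e / (c + 1)) (divr_gt0 e0 c1)) _.
by rewrite lerD2l mulrA ler_pdivrMr // mulrC ler_pM2l //; lra.
Qed.

Lemma ultraI (U : set_system nat) (P Q : set nat) :
  UltraFilter U -> U P -> U Q -> U (P `&` Q).
Proof. by move=> UU; exact: filterI. Qed.

Lemma ultra_meet (U : set_system nat) (P Q : set nat) :
  UltraFilter U -> U P -> U Q -> exists n, P n /\ Q n.
Proof. by move=> UU UP UQ; exact: filter_ex (ultraI UU UP UQ). Qed.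

Lemma bounded_real_converges (U : set_system nat) (a : nat -> R) r :
  UltraFilter U -> (forall n, `|a n| <= r) ->
  exists l, forall e, 0 < e -> U [set n | `|a n - l| < e].
Proof.
move=> UU ar; have UP : ProperFilter U := @ultra_proper _ _ UU.
have Us : U (a @^-1` [set` `[- r, r]]).
  suff -> : a @^-1` [set` `[- r, r]] = setT by exact: filterT.
  by apply/seteqP; split => // n _; rewrite /= in_itv /= -ler_norml.
have [l [_ cl]] := @segment_compact R (- r) r (a @ U) _ Us.
exists l => e e0; have [//|Un] := in_ultra_setVsetC [set n | `|a n - l| < e] UU.
have [|z [/= nz bz]] := cl [set z | ~ `|z - l| < e] (ball l e) _ (nbhsx_ballx l e e0).
  exact: Un.
by case: nz; move: bz; rewrite -ball_normE /= distrC.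
Qed.

Lemma bounded_scalar_converges (U : set_system nat) (a : nat -> R[i]) r :
  UltraFilter U -> (forall n, rnorm (a n) <= r) ->
  exists l, forall e, 0 < e -> U [set n | rnorm (a n - l) < e].
Proof.
move=> UU ar; have UP : ProperFilter U := @ultra_proper _ _ UU.
have [u Hu] := bounded_real_converges UU (fun n => le_trans (Re_le_rnorm (a n)) (ar n)).
have [v Hv] := bounded_real_converges UU (fun n => le_trans (Im_le_rnorm (a n)) (ar n)).
exists (u +i* v)%C => e e0; have e2 : 0 < e / 2 by lra.
apply: filterS (ultraI UU (Hu _ e2) (Hv _ e2)) => n [/= h1 h2].
apply: le_lt_trans (rnorm_le_ReIm _) _.
by move: h1 h2; case: (a n) => s t /=; lra.
Qed.

Lemma exists_free_ultrafilter :
  exists2 U : set_system nat, UltraFilter U & \oo `<=` U.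
Proof. by have [U [UU sU]] := ultraFilterLemma (eventually_filter); exists U. Qed.

Lemma eventually_inv_lt (e : R) : 0 < e -> \oo [set n | (n.+1%:R : R)^-1 < e].
Proof.
move=> e0; exists (Num.bound e^-1) => // n /= le.
rewrite -[e]invrK ltf_pV2 ?posrE ?invr_gt0 //.
apply: lt_le_trans (archi_boundP _) _; first by rewrite invr_ge0 ltW.
by rewrite ler_nat; apply: leq_trans le _.
Qed.

Lemma eventually_nat_ge (c : R) : \oo [set n | c <= n%:R].
Proof.
exists (Num.bound `|c|) => // n /= le; apply: le_trans (ler_norm c) _.
by apply/ltW/(lt_le_trans (archi_boundP (normr_ge0 c))); rewrite ler_nat.
Qed.

Definition eigenvector M (T : V -> V) (l : R[i]) x : Prop :=
  [/\ M x, p x <> 0 & p (T x - l *: x) = 0].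

Lemma sn_normalize x : p x <> 0 -> p ((p x)^-1%:C%C *: x) = 1.
Proof.
move=> x0; rewrite sn_scale // rnorm_real ?mulVf //; first exact/eqP.
by rewrite invr_ge0 sn_ge0.
Qed.

(** If no [c] works there are unit vectors [x_n] and scalars [mu_n] with
    [x_n - mu_n K x_n] tending to [0]; along an ultrafilter [mu_n] and [K x_n]
    converge, hence so does [x_n], to an eigenvector. *)
Lemma compact_disc_bound E K r :
  subspace E -> sn_bounded p K -> compact_on p E K ->
  (forall l x, l != 0 -> ~ eigenvector E K l x) ->
  exists2 c, 0 < c & disc_bound p E K c r.
Proof.
move=> sE [b b0 bK] cK noe; apply: contrapT => nb.
have ex n : exists mx : R[i] * V, [/\ rnorm mx.1 <= r, E mx.2, p mx.2 = 1 &
    p (mx.2 - mx.1 *: K mx.2) < n.+1%:R^-1].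
  apply: contrapT => nex; apply: nb; exists n.+1%:R^-1 => [|mu x mr Ex].
    by rewrite invr_gt0.
  have [->|/eqP x0] := eqVneq (p x) 0; first by rewrite mulr0 sn_ge0.
  have xp := sn_gt0 snp x0.
  rewrite leNgt; apply/negP => lt; apply: nex.
  exists (mu, (p x)^-1%:C%C *: x); split => //=.
  - exact: subspaceZ.
  - exact: sn_normalize.
  - rewrite [K _]linearZ /= scalerA mulrC -scalerA -scalerBr sn_scale //.
    by rewrite rnorm_real ?invr_ge0 ?sn_ge0 // mulrC ltr_pdivrMr.
have {ex} [mx Hmx] := choice ex.
pose mu n := (mx n).1; pose u n := (mx n).2.
have [U UU sU] := exists_free_ultrafilter.
have UP : ProperFilter U := @ultra_proper _ _ UU.
have Eu n : E (u n) by case: (Hmx n).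
have u1 n : p (u n) = 1 by case: (Hmx n).
have mur n : rnorm (mu n) <= r by case: (Hmx n).
have small n : p (u n - mu n *: K (u n)) < n.+1%:R^-1 by case: (Hmx n).
have [y Ey cy] : exists2 y, E y & sn_converges p U (fun n => K (u n)) y.
  by apply: (cK U u 1) => // n; rewrite u1.
have [m cm] := bounded_scalar_converges UU mur.
have r0 : 0 <= r := le_trans (rnorm_ge0 _) (mur 0).
have near e : 0 < e -> exists n,
    p (u n - m *: y) <= (1 + r + p y) * e /\ p (K (u n) - y) < e.
  move=> e0; have [n [/= h1 [/= h2 /= h3]]] := ultra_meet UU (cy e e0)
    (ultraI UU (cm e e0) (sU _ (eventually_inv_lt e0))).
  exists n; split => //.
  apply: le_trans (sn_chain snp (mu n *: K (u n)) _ _) _.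
  have l1 := sn_chain snp (mu n *: y) (mu n *: K (u n)) (m *: y).
  rewrite -scalerBr -scalerBl !sn_scale // in l1.
  have l2 : rnorm (mu n) * p (K (u n) - y) <= r * e.
    by rewrite ler_pM ?rnorm_ge0 ?sn_ge0 // ltW.
  have l3 : rnorm (mu n - m) * p y <= e * p y.
    by rewrite ler_wpM2r ?sn_ge0 // ltW.
  by have := lt_trans (small n) h3; lra.
have c0 : 0 <= 1 + r + p y by have := sn_ge0 snp y; lra.
have my1 : 1 <= p (m *: y).
  apply: (le_of_arbitrarily_small c0) => e e0; have [n [h _]] := near e e0.
  by have := sn_sub snp (u n) (m *: y); rewrite u1; lra.
have m0 : m != 0.
  by apply: contraTneq my1 => ->; rewrite scale0r sn0 // -ltNge.
have y0 : p y <> 0.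
  by move=> e; move: my1; rewrite sn_scale // e mulr0; lra.
apply: (noe m^-1 y); first by rewrite invr_eq0.
split => //; apply: sn_small => // e e0.
have : p (K (m *: y) - y) <= 0.
  apply: (@le_of_arbitrarily_small _ _ (1 + b * (1 + r + p y))) => [|d d0].
    by rewrite addr_ge0 ?mulr_ge0.
  have [n [h1 h2]] := near d d0.
  have := sn_chain snp (K (u n)) (K (m *: y)) y; rewrite -linearB.
  have := bK (m *: y - u n); rewrite (snBC snp (m *: y)).
  have : b * p (u n - m *: y) <= b * ((1 + r + p y) * d) by rewrite ler_wpM2l.
  by rewrite linearB; lra.
rewrite [K _]linearZ /= => h.
have -> : K y - m^-1 *: y = m^-1 *: (m *: K y - y).
  by rewrite scalerBr scalerA mulVf // scale1r.
rewrite sn_scale //; apply: le_trans (ltW e0).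
have := sn_ge0 snp (m *: K y - y) => h'.
by rewrite (_ : p _ = 0) ?mulr0 //; lra.
Qed.

(** A compact operator has a nonzero eigenvalue or is quasinilpotent; of
    quasinilpotence only its consequence for the powers [2 ^ k] is kept. *)
Lemma compact_eigenvector_or_dyadic_bound E K :
  subspace E -> stable E K -> sn_bounded p K -> compact_on p E K ->
  (exists l x, l != 0 /\ eigenvector E K l x) \/
  (forall r, 0 <= r -> dyadic_bound p E K r).
Proof.
move=> sE sK bK cK.
have [|noe] := pselect (exists l x, l != 0 /\ eigenvector E K l x); first by left.
right=> r r0; have [|c c0 low] := @compact_disc_bound E K r sE bK cK _.
  by move=> l x l0 ex; apply: noe; exists l, x.
exact: dyadic_bound_disc c0 low.
Qed.

(** If the identity is compact the space is finite-dimensional, up to null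
    vectors, and eigenvalues exist.  Without dimension theory: every bounded
    operator is then compact, and one without eigenvectors is bounded below,
    which is incompatible with the dyadic bounds. *)
Lemma locally_compact_eigenvector E T x0 :
  subspace E -> stable E T -> sn_bounded p T -> compact_on p E id ->
  E x0 -> p x0 <> 0 -> exists l x, eigenvector E T l x.
Proof.
move=> sE sT bT cE Ex0 x00; have [b b0 bT'] := bT.
have cT : compact_on p E T.
  move=> U u c UU Eu uc; apply: (cE U (fun n => T (u n)) (b * c)) => // n.
    exact: sT.
  by apply: le_trans (bT' _) _; rewrite ler_wpM2l.
have [[l [x [_ ex]]]|bnd] := compact_eigenvector_or_dyadic_bound sE sT bT cT.
  by exists l, x.
apply: contrapT => noe.
have [c c0 low] : exists2 c, 0 < c & forall x, E x -> c * p x <= p (T x).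
  apply: contrapT => nb.
  have ex n : exists x, [/\ E x, p x = 1 & p (T x) < n.+1%:R^-1].
    apply: contrapT => nex; apply: nb; exists n.+1%:R^-1 => [|x Ex].
      by rewrite invr_gt0.
    have [->|/eqP xn0] := eqVneq (p x) 0; first by rewrite mulr0 sn_ge0.
    have xp := sn_gt0 snp xn0.
    rewrite leNgt; apply/negP => lt; apply: nex.
    exists ((p x)^-1%:C%C *: x); split => //=.
    - exact: subspaceZ.
    - exact: sn_normalize.
    - rewrite [T _]linearZ /= sn_scale //.
      by rewrite rnorm_real ?invr_ge0 ?sn_ge0 // mulrC ltr_pdivrMr.
  have {ex} [u Hu] := choice ex.
  have [U UU sU] := exists_free_ultrafilter.
  have UP : ProperFilter U := @ultra_proper _ _ UU.
  have [y Ey cy] : exists2 y, E y & sn_converges p U u y.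
    by apply: (cE U u 1) => // n; case: (Hu n) => // _ ->.
  have near e : 0 < e -> exists n, p (u n - y) < e /\ n.+1%:R^-1 < e.
    move=> e0; have [n [/= h1 /= h2]] := ultra_meet UU (cy e e0) (sU _ (eventually_inv_lt e0)).
    by exists n.
  apply: noe; exists 0, y; split => //.
    move=> y0; have [n [h _]] := near 1 ltr01.
    have [_ u1 _] := Hu n; have := sn_sub snp (u n) y; rewrite u1 y0; lra.
  rewrite scale0r subr0; apply: sn_small => // e e0.
  apply: ltW; apply: le_lt_trans e0.
  apply: (@le_of_arbitrarily_small _ _ (1 + b)) => [|d d0]; first lra.
  have [n [h1 h2]] := near d d0; have [_ _ h3] := Hu n.
  have {}h3 := lt_trans h3 h2.
  have := sn_sub snp (T y) (T (u n)); rewrite -linearB.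
  have := bT' (y - u n); rewrite (snBC snp y).
  have : b * p (u n - y) <= b * d by rewrite ler_wpM2l // ltW.
  by lra.
have lowi n : c ^+ n * p x0 <= p (iter n T x0).
  elim: n => [|n IH]; first by rewrite mul1r.
  apply: le_trans (low _ (stable_iter n sT Ex0)).
  by rewrite exprS -mulrA ler_pM2l.
(* At [r = 2 / c] the two bounds on [p (T ^ N x0)] differ by the factor [2 ^ N]. *)
have [k0 Hk] := bnd (2 / c) (divr_ge0 (ler0n R 2) (ltW c0)).
have := Hk k0 x0 (leqnn _) Ex0.
have N0 : (0 < 2 ^ k0)%N by rewrite expn_gt0.
move: (2 ^ k0)%N N0 => N N0 h.
have h2 : (2 / c) ^+ N * (c ^+ N * p x0) <= p x0.
  apply: le_trans h; apply: ler_wpM2l (lowi N).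
  by apply/exprn_ge0/divr_ge0 => //; exact: ltW.
rewrite mulrA -exprMn divfK ?gt_eqF // in h2.
have h3 : 2 <= (2 : R) ^+ N by rewrite -[X in X <= _]expr1 ler_eXn2l // ltr1n.
have h4 : 2 * p x0 <= 2 ^+ N * p x0 by rewrite ler_wpM2r ?sn_ge0.
by have := sn_gt0 snp x00; lra.
Qed.

(** The identity is compact on the eigenspace of [K] for [l != 0], and [T]
    preserves this eigenspace. *)
Lemma eigenvector_of_commuting E K T l x :
  subspace E -> sn_bounded p K -> compact_on p E K ->
  l != 0 -> eigenvector E K l x ->
  stable E T -> sn_bounded p T ->
  (forall y, E y -> p (T (K y) - K (T y)) = 0) ->
  exists m y, eigenvector E T m y.
Proof.
move=> sE bK cK l0 [Ex x0 ex] sT bT TK; have [b b0 bK'] := bK.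
pose E' : set V := [set y | E y /\ p (K y - l *: y) = 0].
have sE' : subspace E'.
  split; first by split; [exact: subspace0|rewrite linear0 scaler0 subr0 sn0].
  move=> a y z [Ey hy] [Ez hz]; split; first exact: subspaceP.
  apply: sn_small => // e e0; apply: le_trans (ltW e0).
  have -> : K (a *: y + z) - l *: (a *: y + z) =
      a *: (K y - l *: y) + (K z - l *: z).
    rewrite linearP scalerDr scalerBr !scalerA [l * a]mulrC opprD.
    by rewrite addrACA.
  by apply: le_trans (sn_triangle snp _ _) _; rewrite sn_scale // hy hz mulr0 addr0.
have sT' : stable E' T.
  move=> y [Ey hy]; split; first exact: sT.
  have h1 := TK y Ey; rewrite snBC // in h1.
  have h2 : p (T (K y - l *: y)) = 0 by apply: sn_bounded_null hy.
  rewrite linearB [T (_ *: _)]linearZ /= in h2.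
  have := sn_chain snp (T (K y)) (K (T y)) (l *: T y).
  by rewrite h1 h2; have := sn_ge0 snp (K (T y) - l *: T y); lra.
have cE' : compact_on p E' id.
  move=> U u c UU E'u uc; have UP : ProperFilter U := @ultra_proper _ _ UU.
  have [y Ey cy] := cK U u c UU (fun n => (E'u n).1) uc.
  have eu n : p (u n - l^-1 *: y) <= rnorm l^-1 * p (K (u n) - y).
    have -> : u n - l^-1 *: y = l^-1 *: (l *: u n - y).
      by rewrite scalerBr scalerA mulVf // scale1r.
    rewrite sn_scale // ler_wpM2l ?rnorm_ge0 //.
    have := sn_chain snp (K (u n)) (l *: u n) y.
    by rewrite (snBC snp (l *: u n) (K _)) (E'u n).2 add0r.
  have lp : 0 < rnorm l^-1 by rewrite rnorm_gt0 // invr_eq0.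
  exists (l^-1 *: y); last first.
    move=> e e0; have e1 : 0 < e / rnorm l^-1 by rewrite divr_gt0.
    apply: filterS (cy _ e1) => n /= h; apply: le_lt_trans (eu n) _.
    by rewrite mulrC -ltr_pdivlMr.
  split; first exact: subspaceZ.
  rewrite scalerA divff // scale1r; apply: sn_small => // e e0.
  apply: le_trans (ltW e0).
  apply: (@le_of_arbitrarily_small _ _ (1 + b * rnorm l^-1)) => [|d d0].
    by rewrite addr_ge0 ?mulr_ge0 // ltW.
  have [n [/= h _]] := ultra_meet UU (cy d d0) (cy d d0).
  have := sn_chain snp (K (u n)) (K (l^-1 *: y)) y; rewrite -linearB.
  have := bK' (l^-1 *: y - u n); rewrite (snBC snp (l^-1 *: y)).
  have : b * p (u n - l^-1 *: y) <= b * (rnorm l^-1 * d).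
    rewrite ler_wpM2l //; apply: le_trans (eu n) _.
    by rewrite ler_pM2l // ltW.
  by lra.
have [m [y [[Ey _] y0 ey]]] :=
  locally_compact_eigenvector sE' sT' bT cE' (conj Ex ex) x0.
by exists m, y.
Qed.
(** Riesz's almost orthogonal vector.  Were there none, every vector of [E']
    could be approximated from [E] up to half of its size, and iterating would
    place it in the closure of [E]. *)
Lemma riesz_lemma (E E' : set V) x :
  subspace E -> subspace E' -> E `<=` E' -> sn_closed_in p E' E ->
  E' x -> ~ E x ->
  exists y, [/\ E' y, p y <= 1 & forall v, E v -> 1 / 2 <= p (y - v)].
Proof.
move=> sE sE' EE' cE E'x nEx; apply: contrapT => nex; apply: nEx.
have half y : E' y -> exists2 v, E v & p (y - v) <= p y / 2.
  move=> E'y; have [y0|/eqP y0] := eqVneq (p y) 0.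
    by exists 0; [exact: subspace0|rewrite subr0 y0 mul0r].
  have yp := sn_gt0 snp y0.
  pose z := (p y)^-1%:C%C *: y.
  have [v Ev hv] : exists2 v, E v & p (z - v) < 1 / 2.
    apply: contrapT => nv; apply: nex; exists z; split.
    - exact: subspaceZ.
    - by rewrite /z sn_normalize.
    - by move=> v Ev; rewrite leNgt; apply/negP => lt; apply: nv; exists v.
  exists ((p y)%:C%C *: v); first exact: subspaceZ.
  have -> : y - (p y)%:C%C *: v = (p y)%:C%C *: (z - v).
    rewrite scalerBr /z scalerA -rmorphM /= mulfV ?scale1r //; exact/eqP.
  rewrite sn_scale // rnorm_real ?sn_ge0 // ler_wpM2l ?sn_ge0 //.
  by lra.
have approx n : exists2 v, E v & p (x - v) <= p x / 2 ^+ n.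
  elim: n => [|n [v Ev hv]].
    by exists 0; [exact: subspace0|rewrite subr0 expr0 divr1].
  have [w Ew hw] := half _ (subspaceB sE' E'x (EE' _ Ev)).
  exists (v + w); first exact: subspaceD.
  rewrite opprD addrA; apply: le_trans hw _.
  by rewrite exprSr invfM mulrA ler_pM2r // invr_gt0.
apply: cE => // e e0; have [v Ev hv] := approx (Num.bound (p x / e)).
exists v => //; apply: le_lt_trans hv _; move: (archi_boundP (divr_ge0 (sn_ge0 snp x) (ltW e0))).
move: (Num.bound _) => n hn; rewrite ltr_pdivrMr ?exprn_gt0 // mulrC -ltr_pdivrMr //.
apply: lt_trans hn _; rewrite -natrX ltr_nat; exact: ltn_expl.
Qed.
End Compactness.

(** * Hilden's argument and irreducible pairs *)

Section Hilden.
Variables (R : realType) (V : lmodType R[i]) (p : V -> R).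
Hypothesis snp : seminorm p.
Implicit Types (x y : V) (M E : set V) (T K F G : {linear V -> V}).

Definition commutant E K F : Prop :=
  [/\ sn_bounded p F, stable E F & forall y, E y -> p (F (K y) - K (F y)) = 0].

(** Hilden's argument.  Let [U] be a small ball about [w] in [E].  By
    compactness, finitely bounded operators of the commutant suffice to bring
    every [K x] with [x] in [U] back into [U].  Iterating and commuting all
    factors past [K] bounds [p (K ^ n w)] from below by a geometric sequence,
    against the dyadic bounds that hold if [K] has no nonzero eigenvalue. *)
Lemma hilden E K w :
  subspace E -> stable E K -> sn_bounded p K -> compact_on p E K ->
  E w -> p (K w) <> 0 ->
  (forall x e, E x -> p x <> 0 -> 0 < e ->
     exists2 F : {linear V -> V}, commutant E K F & p (F x - w) < e) ->
  exists l x, l != 0 /\ eigenvector p E K l x.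
Proof.
move=> sE sK bK cK Ew Kw0 dense; have [b b0 bK'] := bK.
have Kwp := sn_gt0 snp Kw0.
have wp : 0 < p w by apply: (sn_gt0 snp) => e; apply: Kw0; exact: sn_bounded_null.
have b1 : 0 < b + 1 by lra.
(* Every [x] in the ball has [p x >= p w / 2] and [p (K x) >= p (K w) / 2]. *)
pose e := Num.min (p w / 2) (p (K w) / 2 / (b + 1)).
have e0 : 0 < e by rewrite lt_min !divr_gt0.
have ew : e <= p w / 2 by rewrite ge_min lexx.
have eK : b * e <= p (K w) / 2.
  have : e <= p (K w) / 2 / (b + 1) by rewrite ge_min lexx orbT.
  by rewrite ler_pdivlMr // => h; lra.
pose U x := E x /\ p (x - w) < e.
have UK x : U x -> p (K w) / 2 <= p (K x).
  move=> [_ h]; have := sn_sub snp (K w) (K x); rewrite -linearB.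
  have := bK' (w - x); rewrite (snBC snp w x).
  have : b * p (x - w) <= b * e by rewrite ler_wpM2l // ltW.
  by lra.
have Up x : U x -> p w / 2 <= p x.
  by move=> [_ h]; have := sn_sub snp w x; rewrite (snBC snp w x); lra.
(* A cluster point [y] of a sequence [K (u n)] that defeats the bounds [n] can
   be sent near [w] by one operator [F], and [F] also works for [u n] with [n]
   large. *)
have [r Hr] : exists r : nat, forall x, U x -> exists F : {linear V -> V},
    [/\ commutant E K F, forall z, p (F z) <= r%:R * p z & U (F (K x))].
  apply: contrapT => nex.
  have ex (n : nat) : exists x, U x /\ forall F : {linear V -> V},
      commutant E K F -> (forall z, p (F z) <= n%:R * p z) -> ~ U (F (K x)).
    apply: contrapT => nx; apply: nex; exists n => x Ux; apply: contrapT => nF.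
    by apply: nx; exists x; split => // F cF bF UF; apply: nF; exists F.
  have {ex} [u Hu] := choice ex.
  have [W WW sW] := exists_free_ultrafilter.
  have [y Ey cy] : exists2 y, E y & sn_converges p W (fun n => K (u n)) y.
    apply: (cK W u (p w + e)) => // n; first by case: (Hu n) => -[].
    by have [[_ h] _] := Hu n; have := sn_sub snp (u n) w; lra.
  have y0 : p y <> 0.
    move=> y0; have Kw4 : 0 < p (K w) / 4 by lra.
    have [n [/= h _]] := ultra_meet WW (cy _ Kw4) (cy _ Kw4).
    have := UK _ (Hu n).1; have := sn_sub snp (K (u n)) y.
    by rewrite y0; lra.
  have [|F cF Fy] := dense y (e / 2) Ey y0; first by lra.
  have [[c c0 bF] sF _] := cF.
  have d0 : 0 < e / 2 / (c + 1) by rewrite !divr_gt0 //; lra.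
  have [n [/= h1 h2]] := ultra_meet WW (cy _ d0) (sW _ (eventually_nat_ge c)).
  have [[Eu _] /(_ F cF)] := Hu n; apply.
    by move=> z; apply: le_trans (bF z) _; rewrite ler_wpM2r ?sn_ge0.
  split; first exact/sF/sK.
  apply: le_lt_trans (sn_chain snp (F y) _ _) _; rewrite -linearB.
  have := bF (K (u n) - y); rewrite ltr_pdivlMr in h1; last by lra.
  by have := sn_ge0 snp (K (u n) - y); lra.
have orbit n : exists x, U x /\ exists G : {linear V -> V},
    [/\ commutant E K G, forall z, p (G z) <= r.+1%:R ^+ n * p z &
        p (x - G (iter n K w)) = 0].
  elim: n => [|n [x [Ux [G [cG bG ex]]]]].
    exists w; split; first by split; rewrite ?subrr ?sn0.
    exists idfun; split.
    - by split => // [|y _]; [exact: sn_bounded_id|rewrite subrr sn0].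
    - by move=> z; rewrite expr0 mul1r.
    - by rewrite /= subrr sn0.
  have [F [cF bF UF]] := Hr x Ux; exists (F (K x)); split => //.
  have [bdF sF FK] := cF; have [bdG sG GK] := cG.
  exists (F \o G); split.
  - split; [exact: sn_bounded_comp|by move=> y /sG /sF|].
    move=> y Ey /=.
    have h1 := sn_bounded_eq snp bdF (GK y Ey); have h2 := FK _ (sG _ Ey).
    have := sn_chain snp (F (K (G y))) (F (G (K y))) (K (F (G y))).
    by rewrite h1 h2; have := sn_ge0 snp (F (G (K y)) - K (F (G y))); lra.
  - move=> z /=; apply: le_trans (bF _) _; rewrite exprS -mulrA.
    apply: ler_pM; rewrite ?ler0n ?sn_ge0 ?ler_nat //.
  - rewrite /= -linearB; apply: sn_bounded_null => //.
    have Ei : E (iter n K w) by exact: stable_iter.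
    have h1 := sn_bounded_eq snp bK ex; have := GK _ Ei; rewrite (snBC snp) => h2.
    have := sn_chain snp (K (G (iter n K w))) (K x) (G (K (iter n K w))).
    by rewrite h1 h2; have := sn_ge0 snp (K x - G (K (iter n K w))); lra.
have lower n : p w / 2 <= r.+1%:R ^+ n * p (iter n K w).
  have [x [Ux [G [_ bG ex]]]] := orbit n.
  by apply: le_trans (Up x Ux) _; rewrite (sn_eq snp ex).
have [//|bnd] := compact_eigenvector_or_dyadic_bound snp sE sK bK cK.
(* The factor [2] beats the lower bound as soon as [2 ^ N >= 4]. *)
have r20 : 0 <= 2 * r.+1%:R :> R by rewrite mulr_ge0 ?ler0n.
have [k0 Hk] := bnd _ r20.
have N2 : (2 <= 2 ^ k0.+1)%N by rewrite expnS -[X in (X <= _)%N]muln1 leq_mul2l expn_gt0.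
have := Hk k0.+1 w (leqnSn _) Ew; move: (2 ^ k0.+1)%N N2 => N N2.
rewrite exprMn -mulrA => h.
have h4 : 4 <= (2 : R) ^+ N.
  by rewrite (_ : 4 = 2 ^+ 2) ?ler_eXn2l ?ltr1n // expr2; lra.
have h5 : 4 * (p w / 2) <= 2 ^+ N * (r.+1%:R ^+ N * p (iter N K w)).
  by apply: ler_pM => //; lra.
lra.
Qed.
End Hilden.

Section Irreducible.
Variables (R : realType) (V : lmodType R[i]) (p : V -> R) (M : set V).
Hypotheses (snp : seminorm p) (sM : subspace M).
Implicit Types (x y : V) (A B S T : {linear V -> V}).

(** With [p] the distance to a closed subspace [N] of [M], this says that the
    pair acts irreducibly on the quotient [M / N]. *)
Definition irreducible_pair A B : Prop :=
  forall L : set V, subspace L -> L `<=` M -> sn_closed_in p M L ->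
    stable L A -> stable L B -> (exists2 x, L x & p x <> 0) -> M `<=` L.

Lemma irreducible_pairC A B : irreducible_pair A B -> irreducible_pair B A.
Proof. by move=> irr L sL LM cL LA LB; exact: irr. Qed.

Lemma sn_add0 x y : p x = 0 -> p y = 0 -> p (x + y) = 0.
Proof.
by move=> h1 h2; have := sn_triangle snp x y; have := sn_ge0 snp (x + y); lra.
Qed.

Lemma null_sub_trans y x z : p (x - y) = 0 -> p (y - z) = 0 -> p (x - z) = 0.
Proof. by move=> h1 h2; rewrite -(subrK y x) -addrA sn_add0. Qed.

Lemma null_sub_sym x y : p (x - y) = 0 -> p (y - x) = 0.
Proof. by rewrite (snBC snp). Qed.

Lemma subspace_kernel T : sn_bounded p T -> subspace [set x | M x /\ p (T x) = 0].
Proof.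
move=> bT; split; first by split; [exact: subspace0|rewrite linear0 sn0].
move=> a x y [Mx hx] [My hy]; split; first exact: subspaceP.
by rewrite linearP; apply: sn_add0 => //; rewrite sn_scale // hx mulr0.
Qed.

Lemma closed_kernel T : sn_bounded p T ->
  sn_closed_in p M [set x | M x /\ p (T x) = 0].
Proof.
move=> [b b0 bT] x Mx near; split => //; apply: sn_small => // e e0.
apply: le_trans (ltW e0).
apply: (@le_of_arbitrarily_small _ _ _ b) => // d d0.
have [y [My hy] h] := near d d0.
have := sn_sub snp (T x) (T y); rewrite -linearB hy.
have := bT (x - y); have : b * p (x - y) <= b * d by rewrite ler_wpM2l // ltW.
by lra.
Qed.

(** Schur's lemma: the kernel of an operator commuting with the pair is an
    invariant subspace. *)
Lemma irreducible_kernel A B T x :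
  sn_bounded p A -> sn_bounded p B -> sn_bounded p T ->
  stable M A -> stable M B -> irreducible_pair A B ->
  (forall y, M y -> p (T (A y) - A (T y)) = 0) ->
  (forall y, M y -> p (T (B y) - B (T y)) = 0) ->
  M x -> p x <> 0 -> p (T x) = 0 -> forall y, M y -> p (T y) = 0.
Proof.
move=> bA bB bT MA MB irr TA TB Mx x0 Tx y My.
have stab S : sn_bounded p S -> stable M S ->
    (forall y, M y -> p (T (S y) - S (T y)) = 0) ->
    stable [set x | M x /\ p (T x) = 0] S.
  move=> bS MS TS z [Mz hz]; split; first exact: MS.
  by rewrite (sn_eq snp (TS z Mz)); exact: sn_bounded_null.
suff : [set x | M x /\ p (T x) = 0] y by case.
apply: irr My; [exact: subspace_kernel|by move=> z []|exact: closed_kernel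
  |exact: stab|exact: stab|by exists x].
Qed.

Lemma irreducible_scalar A B T l x :
  sn_bounded p A -> sn_bounded p B -> sn_bounded p T ->
  stable M A -> stable M B -> irreducible_pair A B ->
  (forall y, M y -> p (T (A y) - A (T y)) = 0) ->
  (forall y, M y -> p (T (B y) - B (T y)) = 0) ->
  eigenvector p M T l x -> forall y, M y -> p (T y - l *: y) = 0.
Proof.
move=> bA bB bT MA MB irr TA TB [Mx x0 ex] y My.
pose T' : {linear V -> V} := polyop T ('X - l%:P).
have T'E z : T' z = T z - l *: z by rewrite /T' /= polyopB polyopX polyopC.
have comm S : (forall y, M y -> p (T (S y) - S (T y)) = 0) ->
    forall z, M z -> p (T' (S z) - S (T' z)) = 0.
  move=> TS z Mz; rewrite !T'E linearB [S (l *: z)]linearZ /= opprB addrA subrK.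
  exact: TS.
rewrite -T'E.
apply: (@irreducible_kernel A B T' x) => //; first exact: sn_bounded_polyop.
- exact: comm.
- exact: comm.
- by rewrite T'E.
Qed.

(** Split the polynomial into linear factors: the last vector before the
    product becomes null is an eigenvector. *)
Lemma eigenvector_of_polyop_null T P x :
  stable M T -> P != 0 -> M x -> p x <> 0 -> p (polyop T P x) = 0 ->
  exists l y, eigenvector p M T l y.
Proof.
move=> MT; move eN: (size P) => N.
elim: N P x eN => [|N IH] P x eN P0 Mx x0 Px.
  by move/eqP: eN; rewrite size_poly_eq0 (negPf P0).
have [s1|s1] := eqVneq (size P) 1%N.
  have /eqP/size_poly1P[c c0 eP] := s1.
  case: x0; move/eqP: Px; rewrite eP polyopC sn_scale // mulf_eq0 => /orP[|/eqP//].
  by move/eqP/rnorm_eq0/eqP; rewrite (negPf c0).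
have [l rl] := closed_rootP P s1.
have /factor_theorem[Q eP] := rl.
have Q0 : Q != 0 by apply: contraNneq P0 => Q0; rewrite eP Q0 mul0r.
have sQ : size Q = N.
  by move: eN; rewrite eP size_Mmonic ?monicXsubC // size_XsubC addn2 /= => -[].
pose y := polyop T ('X - l%:P) x.
have [y0|/eqP y0] := eqVneq (p y) 0.
  by exists l, x; split => //; rewrite -[RHS]y0 /y polyopB polyopX polyopC.
apply: (IH Q y sQ Q0 _ y0); first exact: stable_polyop.
by rewrite /y -polyopM -eP.
Qed.

Lemma polyop_commutes_null A B P x :
  sn_bounded p A -> stable M A -> stable M B ->
  (forall y, M y -> p (A (B y) - B (A y)) = 0) ->
  M x -> p (B (polyop A P x) - polyop A P (B x)) = 0.
Proof.
move=> bA MA MB AB; elim/poly_ind: P x => [|P c IH] x Mx.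
  by rewrite !polyop0 linear0 subrr sn0.
rewrite !polyopD !polyopMX !polyopC linearD [B (c *: x)]linearZ /= opprD.
rewrite addrACA subrr addr0; apply: (null_sub_trans (IH _ (MA _ Mx))).
rewrite -linearB; apply: sn_bounded_null => //; first exact: sn_bounded_polyop.
exact/null_sub_sym/AB.
Qed.

Section CommutingCase.
Variables A B : {linear V -> V}.
Hypotheses (bA : sn_bounded p A) (bB : sn_bounded p B).
Hypotheses (MA : stable M A) (MB : stable M B) (irr : irreducible_pair A B).
Hypothesis AB : forall x, M x -> p (A (B x) - B (A x)) = 0.

(** [P(A)] is compact and commutes with the pair, so the orbit of a nonzero
    vector under its commutant is dense by irreducibility and Hilden's argument
    applies to it. *)
Lemma commuting_irreducible_scalar P :
  P != 0 -> compact_on p M (polyop A P) ->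
  exists l, forall x, M x -> p (A x - l *: x) = 0.
Proof.
move=> P0 cP.
have [[x0 Mx0 x00]|triv] := pselect (exists2 x, M x & p x <> 0); last first.
  exists 0 => x Mx; rewrite scale0r subr0; apply: sn_bounded_null => //.
  by apply: contrapT => x0; apply: triv; exists x.
suff [l [x ex]] : exists l x, eigenvector p M A l x.
  exists l; apply: (@irreducible_scalar A B A l x) => //.
  by move=> y _; rewrite subrr sn0.
apply: contrapT => noe.
pose K := polyop A P.
have inj x : M x -> p x <> 0 -> p (K x) <> 0.
  by move=> Mx xn0 Kx; apply: noe; exact: eigenvector_of_polyop_null Kx.
have bK : sn_bounded p K by exact: sn_bounded_polyop.
have MK : stable M K by exact: stable_polyop.
have [|l [x [l0 ex]]] := hilden snp sM MK bK cP Mx0 (inj _ Mx0 x00).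
  move=> x e Mx xn0 e0.
  pose L : set V := [set y | M y /\ forall e, 0 < e ->
    exists2 F : {linear V -> V}, commutant p M K F & p (F x - y) < e].
  suff LM : M `<=` L by have [_ /(_ e e0)] := LM _ Mx0.
  have com_id : commutant p M K idfun.
    by split => // [|y _]; [exact: sn_bounded_id|rewrite subrr sn0].
  have com_lin a F G : commutant p M K F -> commutant p M K G ->
      commutant p M K (a \*: F \+ G).
    move=> [bF MF FK] [bG MG GK]; split; first exact: sn_bounded_lin.
      by move=> y My /=; apply: subspaceP => //; [exact: MF|exact: MG].
    move=> y My /=; rewrite linearP opprD addrACA -scalerBr; apply: sn_add0.
      by rewrite sn_scale // FK ?mulr0.
    exact: GK.
  have com_comp F G : commutant p M K F -> commutant p M K G ->
      commutant p M K (F \o G).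
    move=> [bF MF FK] [bG MG GK]; split; first exact: sn_bounded_comp.
      by move=> y My /=; exact/MF/MG.
    move=> y My /=; apply: null_sub_trans (FK _ (MG _ My)).
    by apply: sn_bounded_eq => //; exact: GK.
  have stab T : commutant p M K T -> stable L T.
    move=> cT y [My hy]; have [[b b0 bT] MT _] := cT; split; first exact: MT.
    move=> d d0; have b1 : 0 < b + 1 by lra.
    have [F cF Fy] := hy (d / (b + 1)) (divr_gt0 d0 b1).
    exists (T \o F); first exact: com_comp.
    rewrite /= -linearB; apply: le_lt_trans (bT _) _.
    move: Fy; rewrite ltr_pdivlMr // => h.
    by have := sn_ge0 snp (F x - y); lra.
  have L0 : L 0.
    split; first exact: subspace0.
    move=> d d0; exists ((-1) \*: idfun \+ idfun); first exact: com_lin.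
    by rewrite /= scaleN1r addNr subrr sn0.
  apply: (irr (L := L)).
  - split=> // a y z [My hy] [Mz hz]; split; first exact: subspaceP.
    move=> d d0; have a1 : 0 < rnorm a + 1 by have := rnorm_ge0 a; lra.
    have d2 : 0 < d / 2 by lra.
    have [F cF Fy] := hy (d / 2 / (rnorm a + 1)) (divr_gt0 d2 a1).
    have [G cG Gz] := hz (d / 2) d2.
    exists (a \*: F \+ G); first exact: com_lin.
    rewrite /= opprD addrACA -scalerBr; apply: le_lt_trans (sn_triangle snp _ _) _.
    rewrite sn_scale //; move: Fy; rewrite ltr_pdivlMr // => h.
    by have := sn_ge0 snp (F x - y); lra.
  - by move=> y [].
  - move=> y My near; split => // d d0; have d2 : 0 < d / 2 by lra.
    have [z [Mz hz] yz] := near _ d2; have [F cF Fz] := hz _ d2.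
    exists F => //; apply: le_lt_trans (sn_chain snp z _ _) _.
    by rewrite (snBC snp z); lra.
  - apply: stab; split => // y My; apply: null_sub_sym.
    by rewrite /= polyop_comm subrr sn0.
  - by apply: stab; split => // y My; exact: polyop_commutes_null.
  - exists x => //; split => // d d0; exists idfun => //=.
    by rewrite subrr sn0.
have [|m [y ey]] := eigenvector_of_commuting snp sM bK cP l0 ex MA bA.
  by move=> y _; rewrite /= polyop_comm subrr sn0.
by apply: noe; exists m, y.
Qed.

End CommutingCase.
End Irreducible.

(** * Irreducible pairs commute *)

Section NoncommutingCase.
Variables (R : realType) (V : lmodType R[i]) (p : V -> R) (M : set V).
Hypotheses (snp : seminorm p) (sM : subspace M).
Implicit Types (x y : V).

Variables A B : {linear V -> V}.
Hypotheses (bA : sn_bounded p A) (bB : sn_bounded p B).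
Hypotheses (MA : stable M A) (MB : stable M B) (irr : irreducible_pair p M A B).

(** [S] stands for [AB] and [C] for [AB - BA]; the hypotheses [AC = CB = 0] say
    that [S] commutes with [A] and [B]. *)
Variables S C : {linear V -> V}.
Hypotheses (SE : forall x, S x = A (B x)) (CE : forall x, C x = S x - B (A x)).
Hypotheses (SA : forall x, S (A x) = A (S x)) (SB : forall x, S (B x) = B (S x)).

Let SC x : S (C x) = C (S x). Proof. by rewrite !CE linearB SB SA. Qed.
Let AC x : A (C x) = 0. Proof. by rewrite CE linearB -SE SA subrr. Qed.
Let CB x : C (B x) = 0. Proof. by rewrite CE SB SE subrr. Qed.

Let bS : sn_bounded p S.
Proof. by have [c c0 h] := sn_bounded_comp bA bB; exists c => // x; rewrite SE; exact: h. Qed.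
Let MS : stable M S. Proof. by move=> x Mx; rewrite SE; exact/MA/MB. Qed.
Let MC : stable M C.
Proof. by move=> x Mx; rewrite CE; apply: (subspaceB sM); [exact: MS|exact/MB/MA]. Qed.
Let bC : sn_bounded p C.
Proof.
have [a a0 ha] := bS; have [b b0 hb] := sn_bounded_comp bB bA.
exists (a + b); first exact: addr_ge0.
move=> x; rewrite CE; apply: le_trans (snB snp _ _) _; rewrite mulrDl lerD //.
exact: hb.
Qed.

Let iterSA n x : iter n S (A x) = A (iter n S x).
Proof. by elim: n => [|n IH] //; rewrite !iterS IH SA. Qed.

Let iterAS n x : iter n A (S x) = S (iter n A x).
Proof. by elim: n => [|n IH] //; rewrite !iterS IH SA. Qed.

Let iterA_iterB n x : iter n A (iter n B x) = iter n S x.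
Proof.
elim: n => [|n IH] //.
by rewrite iterSr [iter n.+1 B x]iterS -SE iterAS IH.
Qed.

Section NonzeroCommutator.
Variable z0 : V.
Hypotheses (Mz0 : M z0) (Cz0 : p (C z0) <> 0).

Let z := C z0.
Let Mz : M z. Proof. exact: MC. Qed.
Let Az : A z = 0. Proof. exact: AC. Qed.

(** By Schur's lemma [S = AB] is injective or null.  If it is null, the kernel of
    [A] is invariant under [B] and contains [z], so [A] is null, and so is [C]. *)
Let S_injective x : M x -> p x <> 0 -> p (S x) <> 0.
Proof.
move=> Mx x0 Sx.
have S0 y : M y -> p (S y) = 0.
  apply: (@irreducible_kernel _ _ p M snp sM A B S x) => //.
  - by move=> y0 _; rewrite SA subrr sn0.
  - by move=> y0 _; rewrite SB subrr sn0.
have A0 : M `<=` [set x | M x /\ p (A x) = 0].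
  apply: irr.
  - exact: subspace_kernel.
  - by move=> y [].
  - exact: closed_kernel.
  - by move=> y [My Ay]; split; [exact: MA|exact: sn_bounded_null].
  - by move=> y [My Ay]; split; [exact: MB|rewrite -SE; exact: S0].
  - by exists z => //; split => //; rewrite Az sn0.
apply: Cz0; rewrite CE; apply: sn_add0 => //; first exact: S0.
by rewrite snN //; apply: sn_bounded_null => //; case: (A0 _ Mz0).
Qed.

Let iterS_injective n x : M x -> p x <> 0 -> p (iter n S x) <> 0.
Proof.
move=> Mx x0; elim: n => [|n IH] //; rewrite iterS; apply: S_injective => //.
exact: stable_iter.
Qed.

Let N : set V := [set x | M x /\ p (A x) = 0].
Let sN : subspace N. Proof. exact: subspace_kernel. Qed.
Let NS : stable N S.
Proof.
by move=> x [Mx Ax]; split; [exact: MS|rewrite -SA; exact: sn_bounded_null].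
Qed.

(** The closure of the span of [S^i x] with [i > 0]. *)
Let W x : set V := [set v | forall e, 0 < e ->
  exists f : {poly R[i]}, p (polyop S f (S x) - v) < e].

(** The set of [y] with all [C (A^i y)] in [W x] is a closed subspace, invariant
    under [B] because [C B = 0] and [A B] is central; it contains [x]. *)
Let C_orbit x : N x -> p x <> 0 -> forall y, M y -> W x (C y).
Proof.
move=> [Mx Ax] x0 y My.
pose L : set V := [set y | M y /\ forall i, W x (C (iter i A y))].
suff ML : M `<=` L by have [_ /(_ 0)] := ML _ My.
have W_null v w : p (v - w) = 0 -> W x v -> W x w.
  move=> vw Wv e e0; have [f hf] := Wv e e0; exists f.
  by have := sn_chain snp v (polyop S f (S x)) w; lra.
have W0 : W x 0 by move=> e e0; exists 0; rewrite polyop0 subrr sn0.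
apply: irr.
- split.
    split; first exact: subspace0.
    by move=> i; rewrite (_ : iter i A 0 = 0) ?linear0 //; elim: i => //= i ->; exact: linear0.
  move=> a u v [Mu Wu] [Mv Wv]; split; first exact: subspaceP.
  move=> i e e0; have e2 : 0 < e / 2 by lra.
  have a1 : 0 < rnorm a + 1 by have := rnorm_ge0 a; lra.
  have [f hf] := Wu i (e / 2 / (rnorm a + 1)) (divr_gt0 e2 a1).
  have [g hg] := Wv i (e / 2) e2.
  exists (a *: f + g); rewrite polyopD polyopZ (iter_linear A i) linearP opprD addrACA.
  rewrite -scalerBr; apply: le_lt_trans (sn_triangle snp _ _) _; rewrite sn_scale //.
  move: hf; rewrite ltr_pdivlMr // => hf.
  by have := sn_ge0 snp (polyop S f (S x) - C (iter i A u)); lra.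
- by move=> u [].
- move=> u Mu near; split => // i e e0.
  have [c c0 bc] := sn_bounded_comp bC (sn_bounded_iter i bA).
  have e2 : 0 < e / 2 by lra.
  have c1 : 0 < c + 1 by lra.
  have [v [Mv Wv] uv] := near _ (divr_gt0 e2 c1).
  have [f hf] := Wv i (e / 2) e2; exists f.
  apply: le_lt_trans (sn_chain snp (C (iter i A v)) _ _) _.
  have := bc (v - u); move: uv; rewrite ltr_pdivlMr // (snBC snp u v) => uv.
  have -> : (C \o iter i A) (v - u) = C (iter i A v) - C (iter i A u).
    by rewrite /comp -!polyopXn !linearB.
  by have := sn_ge0 snp (v - u); lra.
- by move=> u [Mu Wu]; split; [exact: MA|move=> i; rewrite -iterSr; exact: Wu].
- move=> u [Mu Wu]; split; first exact: MB.
  case=> [|i]; first by rewrite CB.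
  rewrite iterSr -SE iterAS -SC => e e0.
  have [b b0 hb] := bS; have b1 : 0 < b + 1 by lra.
  have [f hf] := Wu i (e / (b + 1)) (divr_gt0 e0 b1).
  exists ('X * f); rewrite polyopM polyopX -linearB.
  move: hf; rewrite ltr_pdivlMr // => hf.
  apply: le_lt_trans (hb _) _.
  by have := sn_ge0 snp (polyop S f (S x) - C (iter i A u)); lra.
- exists x => //; split => // -[|i].
    apply: (W_null (S x)); first by rewrite CE opprB addrC subrK; exact: sn_bounded_null.
    by move=> e e0; exists 1; rewrite polyop1 subrr sn0.
  apply: W_null W0; rewrite sub0r snN // iterSr; apply: sn_bounded_null => //.
  by apply: sn_bounded_null => //; exact: sn_bounded_iter.
Qed.

(** [P = Q * 'X^k] is the polynomial with [P(A)] compact, and [k] is the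
    multiplicity of its root [0]. *)
Variables (Q Q' : {poly R[i]}) (q0 : R[i]) (k : nat).
Hypotheses (q00 : q0 != 0) (QE : Q = Q' * 'X + q0%:P).
Hypothesis cP : compact_on p M (polyop A (Q * 'X^k)).

Let QE' x : polyop A Q x = q0 *: x + polyop A Q' (A x).
Proof. by rewrite QE polyopD polyopMX polyopC addrC. Qed.

(** [P(A) B^k = Q(A) (AB)^k]: multiplying by [B^k] trades the factor [A^k],
    which may be far from invertible, for a power of the central operator. *)
Let K1_compact : compact_on p M (fun x => polyop A Q (iter k S x)).
Proof.
move=> U u c UU Mu uc; have [b b0 hb] := sn_bounded_iter k bB.
have [||y My cy] := cP UU (u := fun n => iter k B (u n)) (c := b * c).
- by move=> n; exact: stable_iter.
- by move=> n; apply: le_trans (hb _) _; rewrite ler_wpM2l.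
exists y => // e e0; have := cy e e0.
by under eq_fun do rewrite polyopM polyopXn iterA_iterB.
Qed.

Let K := polyop S 'X^k.

Let K_compact : compact_on p N K.
Proof.
move=> U u c UU Nu uc.
have [y My cy] := K1_compact UU (fun n => (Nu n).1) uc.
have qp : 0 < rnorm q0^-1 by rewrite rnorm_gt0 // invr_eq0.
have cv : sn_converges p U (fun n => K (u n)) (q0^-1 *: y).
  move=> e e0; have e1 : 0 < e / rnorm q0^-1 by rewrite divr_gt0.
  have [UP _] := UU; apply: filterS (cy _ e1) => n /=.
  rewrite ltr_pdivlMr // mulrC -sn_scale // scalerBr QE' scalerDr scalerA mulVf //.
  rewrite scale1r /K polyopXn => h; apply: le_lt_trans h.
  set a := iter k S (u n); set d := q0^-1 *: polyop A Q' (A a).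
  have d0 : p d = 0.
    rewrite /d sn_scale //; have -> : p (polyop A Q' (A a)) = 0; last by rewrite mulr0.
    apply: sn_bounded_null => //; first exact: sn_bounded_polyop.
    by rewrite /a -iterSA; apply: sn_bounded_null => //; [exact: sn_bounded_iter|case: (Nu n)].
  have := sn_chain snp (a + d) a (q0^-1 *: y).
  by rewrite opprD addrA subrr sub0r snN // d0; lra.
exists (q0^-1 *: y) => //.
apply: (closed_kernel snp bA) => [|e e0]; first exact: subspaceZ.
have [n [/= h _]] := ultra_meet UU (cv e e0) (cv e e0).
exists (K (u n)); last by rewrite (snBC snp).
exact: (stable_polyop sN 'X^k NS (Nu n)).
Qed.

(** Hilden's argument applies to the compact operator [S^k] on the kernel of
    [A]: by [C_orbit] the vector [C z = S z] is a limit of [f(S) S x] for every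
    nonnull [x] of the kernel. *)
Let S_eigenvector : exists l x, eigenvector p N S l x.
Proof.
have NK : stable N K by exact: stable_polyop.
have bK : sn_bounded p K by exact: sn_bounded_polyop.
have Nz : N z by split => //; rewrite Az sn0.
have [||x e Nx x0 e0|l [x [l0 ex]]] := @hilden _ _ p snp N K (S z) sN NK bK K_compact.
- exact: NS.
- by rewrite /K /= polyopXn -iterSr; exact: iterS_injective.
- have [f hf] := C_orbit Nx x0 Mz e0.
  exists (polyop S (f * 'X)).
    split; [exact: sn_bounded_polyop|exact: stable_polyop|].
    by move=> y _; rewrite /K /= -!polyopM mulrC subrr sn0.
  by rewrite /= polyopMX; move: hf; rewrite CE Az linear0 subr0.
apply: (eigenvector_of_commuting snp sN bK K_compact l0 ex NS bS) => y _.
by rewrite /K /= polyop_comm subrr sn0.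
Qed.

Let Nn n : set V := [set x | M x /\ p (iter n A x) = 0].

(** [S] is now a nonzero scalar, so the kernels of [A^n] increase strictly while
    a compact operator acts on each quotient of successive kernels as one
    nonzero scalar. *)
Lemma nonzero_commutator_absurd : False.
Proof.
have [l [x [[Mx _] x0 ex]]] := S_eigenvector.
have Sl : forall y, M y -> p (S y - l *: y) = 0.
  apply: (@irreducible_scalar _ _ p M snp sM A B S l x) => //.
  - by move=> y _; rewrite SA subrr sn0.
  - by move=> y _; rewrite SB subrr sn0.
have l0 : l != 0.
  apply: contra_notN (S_injective Mx x0) => /eqP l0.
  by rewrite (sn_eq snp ex) l0 scale0r sn0.
have Skl y : M y -> p (iter k S y - l ^+ k *: y) = 0.
  move=> My; elim: k => [|j IH]; first by rewrite scale1r subrr sn0.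
  apply: (null_sub_trans snp (sn_bounded_eq snp bS IH)).
  by rewrite linearZ /= exprSr -scalerA -scalerBr sn_scale // Sl ?mulr0.
have bAn n := sn_bounded_iter n bA.
have NnP n : Nn n = [set x | M x /\ p (polyop A 'X^n x) = 0].
  by apply/seteqP; split => y [My h]; split => //; move: h; rewrite polyopXn.
have sNn n : subspace (Nn n).
  by rewrite NnP; apply: subspace_kernel => //; exact: sn_bounded_polyop.
have cNn n : sn_closed_in p M (Nn n).
  by rewrite NnP; apply: closed_kernel => //; exact: sn_bounded_polyop.
have incr n m : (n <= m)%N -> Nn n `<=` Nn m.
  move=> le y [My h]; split => //; rewrite -(subnK le) iterD.
  exact: (sn_bounded_null snp (bAn _) h).
have NnA P n : stable (Nn n) (polyop A P).
  move=> y [My h]; split; first exact: stable_polyop.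
  rewrite -polyopXn -polyopM mulrC polyopM polyopXn.
  by apply: sn_bounded_null => //; exact: sn_bounded_polyop.
have Nn_null n y y' : M y -> p (y - y') = 0 -> Nn n y' -> Nn n y.
  by move=> My h [My' h']; split => //; rewrite -h'; apply: sn_eq => //; rewrite -!polyopXn; apply: sn_bounded_eq => //; exact: sn_bounded_polyop.
pose K1 := polyop A Q \o polyop S 'X^k.
have K1E y : K1 y = polyop A Q (iter k S y) by rewrite /K1 /= polyopXn.
have MK1 : stable M K1.
  by move=> y My; apply: stable_polyop => //; exact: stable_polyop.
have K1l y : M y -> p (K1 y - l ^+ k *: polyop A Q y) = 0.
  move=> My; rewrite K1E -linearZ; apply: sn_bounded_eq => //.
    exact: sn_bounded_polyop.
  exact: Skl.
pose kap := l ^+ k * q0.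
have kap0 : kap != 0 by rewrite mulf_neq0 // expf_neq0.
have K1N n : stable (Nn n) K1.
  move=> y Ny; apply: (@Nn_null n _ (l ^+ k *: polyop A Q y)).
  - by apply: MK1; case: Ny.
  - by apply: K1l; case: Ny.
  - by apply: subspaceZ => //; exact: NnA.
have K1S n y : Nn n.+1 y -> Nn n (kap *: y - K1 y).
  move=> [My Ay].
  apply: (@Nn_null n _ (- (l ^+ k *: polyop A Q' (A y)))).
  - by apply: subspaceB => //; [exact: subspaceZ|exact: MK1].
  - have -> : kap *: y - K1 y - - (l ^+ k *: polyop A Q' (A y)) =
        l ^+ k *: polyop A Q y - K1 y.
      by rewrite QE' scalerDr scalerA opprK addrAC.
    by rewrite (snBC snp) K1l.
  - apply: subspaceN => //; apply: subspaceZ => //; apply: NnA.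
    by split; [exact: MA|rewrite -iterSr].
have ex_riesz n : exists y, [/\ Nn n.+1 y, p y <= 1 &
    forall v, Nn n v -> 1 / 2 <= p (y - v)].
  apply: (riesz_lemma snp (x := iter n B z)) => //.
  - exact: incr.
  - by move=> v [Mv _]; exact: cNn.
  - split; first exact: stable_iter.
    by rewrite iterS iterA_iterB -iterSA Az -polyopXn linear0 sn0.
  - move=> [_]; rewrite iterA_iterB; exact: iterS_injective.
have {ex_riesz} [u Hu] := choice ex_riesz.
have [U UU sU] := exists_free_ultrafilter.
have Mu n : M (u n) by case: (Hu n) => -[].
have u1 n : p (u n) <= 1 by case: (Hu n).
have [v Mv cv] := K1_compact UU Mu u1.
have kp := rnorm_gt0 kap0.
have kp8 : 0 < rnorm kap / 8 by lra.
have [m [/= hm _]] := ultra_meet UU (cv _ kp8) (cv _ kp8).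
have [n [/= hn mn]] := ultra_meet UU (cv _ kp8) (sU _ (nbhs_infty_gt m)).
have [Nun _ dist] := Hu n; have [Num _ _] := Hu m.
rewrite -K1E in hm; rewrite -K1E in hn.
(* Modulo [Nn n] the operator [K1] is multiplication by [kap] on [Nn n.+1], so
   [K1 (u n) - K1 (u m)] is [kap] times a vector [u n - w] with [w] in [Nn n]. *)
pose w := kap^-1 *: (kap *: u n - K1 (u n) + K1 (u m)).
have Nw : Nn n w.
  apply: subspaceZ => //; apply: subspaceD => //; first exact: K1S.
  by apply: K1N; exact: incr Num.
have := dist w Nw.
have -> : u n - w = kap^-1 *: (K1 (u n) - K1 (u m)).
  rewrite /w scalerDr !scalerBr scalerA mulVf // scale1r opprD opprB addrA.
  by rewrite [u n + _]addrC subrK.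
rewrite sn_scale // rnormV [_^-1 * p _]mulrC ler_pdivlMr //.
have := sn_chain snp v (K1 (u n)) (K1 (u m)).
by rewrite (snBC snp v); lra.
Qed.
End NonzeroCommutator.


(** All powers of [A] and [B] are organised around the central operator [S].
    Should [C] not be null, [S] would be a nonzero scalar, so that [A] and [B]
    would act like the backward and forward shift, and no nonzero polynomial in
    the backward shift is compact. *)
Lemma irreducible_commutator_null P :
  P != 0 -> compact_on p M (polyop A P) -> forall x, M x -> p (C x) = 0.
Proof.
move=> P0 cP x Mx; apply: contrapT => Cx.
have [k [Q Q0 PE]] := multiplicity_XsubC P 0.
rewrite P0 /= in Q0; rewrite subr0 in PE.
have /factor_theorem[Q' QE] : root (Q - Q.[0]%:P) 0.
  by rewrite rootE !hornerE subrr.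
rewrite subr0 in QE.
apply: (@nonzero_commutator_absurd x Mx Cx Q Q' Q.[0] k).
- exact: Q0.
- by rewrite -QE subrK.
- by rewrite -PE.
Qed.
End NoncommutingCase.

Section Scalars.
Variables (R : realType) (V : lmodType R[i]) (p : V -> R) (M : set V).
Hypotheses (snp : seminorm p) (sM : subspace M).
Variables A B : {linear V -> V}.

Lemma irreducible_pair_scalar P Q :
  sn_bounded p A -> sn_bounded p B -> stable M A -> stable M B ->
  irreducible_pair p M A B ->
  (forall x, A (A (B x)) = A (B (A x))) ->
  (forall x, A (B (B x)) = B (A (B x))) ->
  P != 0 -> compact_on p M (polyop A P) ->
  Q != 0 -> compact_on p M (polyop B Q) ->
  exists a b, forall x, M x -> p (A x - a *: x) = 0 /\ p (B x - b *: x) = 0.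
Proof.
move=> bA bB MA MB irr AAB ABB P0 cP Q0 cQ.
have AB x : M x -> p (A (B x) - B (A x)) = 0.
  move=> Mx; apply: (irreducible_commutator_null snp sM bA bB MA MB irr
    (S := A \o B) (C := (A \o B) \- (B \o A)) _ _ _ _ P0 cP Mx) => // y /=.
  by rewrite AAB.
have [a ha] := commuting_irreducible_scalar snp sM bA bB MA MB irr AB P0 cP.
have [|b hb] := commuting_irreducible_scalar snp sM bB bA MB MA
  (irreducible_pairC irr) _ Q0 cQ.
  by move=> x /AB/(null_sub_sym snp).
by exists a, b => x Mx; split; [exact: ha|exact: hb].
Qed.
End Scalars.

(** * The distance to a subspace as a seminorm *)

Section Distance.
Variables (R : realType) (X : normedModType R[i]).
Implicit Types (x y : X) (M N : set X) (T K : {linear X -> X}).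

Definition norm_closed M : Prop :=
  forall x, (forall e : R, 0 < e -> exists2 y, M y & rnorm (x - y) < e) -> M x.

Lemma ball_rnorm x y (e : R) : ball x e%:C%C y <-> rnorm (x - y) < e.
Proof. by rewrite -ball_normE /= -rnormE ltcR. Qed.

Lemma norm_closedP M : closed M <-> norm_closed M.
Proof.
split=> [cM x near|cM x clx].
  apply: cM => B /nbhs_ballP[e /= e0 sB].
  have [er ee] : exists r : R, e = r%:C%C.
    by exists (complex.Re e); rewrite RRe_real // gtr0_real.
  rewrite ee ltcR in e0; have [y My hy] := near er e0.
  by exists y; split => //; apply: sB; rewrite ee; apply/ball_rnorm.
apply: cM => e e0; have [|y [My /ball_rnorm hy]] := clx (ball x e%:C%C).
  by apply: nbhsx_ballx; rewrite ltcR.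
by exists y.
Qed.

Lemma closed_subspaceP M : submod_closed (mem M) /\ closed M <-> subspace M /\ norm_closed M.
Proof.
have E x : (x \in (mem M : {pred X})) = (x \in M) by [].
split=> -[sM /norm_closedP cM]; split => //.
  case: sM => M0 Ml; split; first by move: M0; rewrite E inE.
  by move=> a x y Mx My; have := Ml a x y; rewrite !E !inE; apply.
case: sM => M0 Ml; split; first by rewrite E inE.
by move=> a x y; rewrite !E !inE; exact: Ml.
Qed.

Section ToSubspace.
Variable N : set X.
Hypothesis sN : subspace N.

(** On a subspace [M] containing [N], this is the quotient norm of [M / N]. *)
Definition subspace_dist x : R := inf [set rnorm (x - y) | y in N].

Let has_inf_dist x : has_inf [set rnorm (x - y) | y in N].
Proof.
split; first by exists (rnorm (x - 0)); exists 0 => //; exact: subspace0.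
by exists 0 => _ [y _ <-]; exact: rnorm_ge0.
Qed.

Lemma subspace_dist_le x y : N y -> subspace_dist x <= rnorm (x - y).
Proof. by move=> Ny; apply: ge_inf; [case: (has_inf_dist x)|exists y]. Qed.

Lemma subspace_dist_lt x r : subspace_dist x < r ->
  exists2 y, N y & rnorm (x - y) < r.
Proof.
by move=> lt; have [_ [y Ny <-] h] := inf_lt (has_inf_dist x).1 lt; exists y.
Qed.

Lemma subspace_dist_le_rnorm x : subspace_dist x <= rnorm x.
Proof. by have := subspace_dist_le x (subspace0 sN); rewrite subr0. Qed.

Lemma subspace_dist_ge0 x : 0 <= subspace_dist x.
Proof.
apply: lb_le_inf; first by case: (has_inf_dist x).
by move=> _ [y _ <-]; exact: rnorm_ge0.
Qed.

Lemma subspace_dist0 x : N x -> subspace_dist x = 0.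
Proof.
move=> Nx; apply/eqP; rewrite eq_le subspace_dist_ge0 andbT.
by have := subspace_dist_le x Nx; rewrite subrr rnorm0.
Qed.

Lemma subspace_dist_seminorm : seminorm subspace_dist.
Proof.
have le a x : subspace_dist (a *: x) <= rnorm a * subspace_dist x.
  apply: (@le_of_arbitrarily_small _ _ _ (rnorm a)); first exact: rnorm_ge0.
  move=> e e0; have [|y Ny hy] := @subspace_dist_lt x (subspace_dist x + e).
    by rewrite ltrDl.
  apply: le_trans (subspace_dist_le _ (subspaceZ sN a Ny)) _.
  by rewrite -scalerBr rnormZ -mulrDr ler_wpM2l ?rnorm_ge0 // ltW.
split=> [x y|a x].
  apply: (@le_of_arbitrarily_small _ _ _ 2) => // e e0.
  have [|u Nu hu] := @subspace_dist_lt x (subspace_dist x + e); first by rewrite ltrDl.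
  have [|v Nv hv] := @subspace_dist_lt y (subspace_dist y + e); first by rewrite ltrDl.
  apply: le_trans (subspace_dist_le _ (subspaceD sN Nu Nv)) _.
  by rewrite opprD addrACA; have := rnormD (x - u) (y - v); lra.
have [->|a0] := eqVneq a 0.
  by rewrite scale0r rnorm0 mul0r; exact: subspace_dist0 (subspace0 sN).
apply/eqP; rewrite eq_le le /=.
have := le a^-1 (a *: x); rewrite scalerA mulVf // scale1r rnormV => h.
by rewrite mulrC -ler_pdivlMr ?rnorm_gt0 // mulrC.
Qed.

Lemma subspace_dist_eq0 x : norm_closed N -> subspace_dist x = 0 -> N x.
Proof.
by move=> cN x0; apply: cN => e e0; apply: subspace_dist_lt; rewrite x0.
Qed.

Lemma subspace_dist_bounded T c : 0 <= c -> (forall x, rnorm (T x) <= c * rnorm x) ->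
  stable N T -> sn_bounded subspace_dist T.
Proof.
move=> c0 bT NT; exists c => // x.
apply: (@le_of_arbitrarily_small _ _ _ c) => // e e0.
have [|y Ny hy] := @subspace_dist_lt x (subspace_dist x + e); first by rewrite ltrDl.
apply: le_trans (subspace_dist_le _ (NT _ Ny)) _; rewrite -linearB.
by apply: le_trans (bT _) _; rewrite -mulrDr ler_wpM2l // ltW.
Qed.

(** Correct a sequence bounded modulo [N] by vectors of [N] so that it becomes
    bounded in norm. *)
Lemma subspace_dist_compact M K : subspace M -> norm_closed M -> N `<=` M ->
  stable M K -> stable N K ->
  precompact (K @` [set x : X | `|x| <= 1]) -> compact_on subspace_dist M K.
Proof.
move=> sM cM NM MK NK [Z KZ [cZ _]] U u c UU Mu uc.
have UP : ProperFilter U := @ultra_proper _ _ UU.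
have c0 : 0 <= c := le_trans (subspace_dist_ge0 _) (uc 0).
have c1 : 0 < c + 1 by lra.
have ex n : exists v, N v /\ rnorm (u n - v) < c + 1.
  have [|v Nv hv] := @subspace_dist_lt (u n) (c + 1); last by exists v.
  by have := uc n; lra.
have {ex} [v Hv] := choice ex.
pose w n := (c + 1)^-1%:C%C *: (u n - v n).
have w1 n : `|w n| <= 1.
  rewrite -rnormE -[1]/(1%:C%C) lecR rnormZ rnorm_real ?invr_ge0 ?(ltW c1) //.
  by rewrite mulrC ler_pdivrMr // mul1r; case: (Hv n) => _ /ltW.
have Mw n : M (w n).
  by apply: subspaceZ => //; apply: subspaceB => //; case: (Hv n) => /NM.
have FZ : U ((K \o w) @^-1` Z).
  suff -> : (K \o w) @^-1` Z = setT by exact: filterT.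
  by apply/seteqP; split => // n _; apply: KZ; exists (w n) => //=; exact: w1.
have [y [_ cl]] := cZ ((K \o w) @ U) _ FZ.
have cy (e : R) : 0 < e -> U [set n | rnorm (K (w n) - y) < e].
  move=> e0; have [//|Un] := in_ultra_setVsetC [set n | rnorm (K (w n) - y) < e] UU.
  have nb : nbhs y (ball y e%:C%C) by apply: nbhsx_ballx; rewrite ltcR.
  have [z [/= nz /ball_rnorm bz]] := cl [set z | ~ rnorm (z - y) < e] _ Un nb.
  by case: nz; rewrite rnormBC.
exists ((c + 1)%:C%C *: y).
  apply: subspaceZ => //; apply: cM => e e0.
  have [n [/= h _]] := ultra_meet UU (cy e e0) (cy e e0).
  by exists (K (w n)); [exact: MK|rewrite rnormBC].
move=> e e0; apply: filterS (cy _ (divr_gt0 e0 c1)) => n /= h.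
have [Nv _] := Hv n; apply: le_lt_trans (subspace_dist_le _ (NK _ Nv)) _.
have -> : K (u n) - (c + 1)%:C%C *: y - K (v n) =
    (c + 1)%:C%C *: (K (w n) - y).
  rewrite /w [K (_ *: _)]linearZ /= scalerBr scalerA -rmorphM /= mulfV ?gt_eqF // scale1r.
  by rewrite linearB addrAC.
by rewrite rnormZ rnorm_real ?ltW // mulrC -ltr_pdivlMr.
Qed.
End ToSubspace.

Lemma rnorm_bounded T : bounded_near T (nbhs (0 : X)) ->
  exists2 c, 0 <= c & forall x, rnorm (T x) <= c * rnorm x.
Proof.
move=> /linear_boundedP[m [mr H]].
exists (`|complex.Re m| + 1) => [|x]; first by rewrite addr_ge0.
rewrite -lecR rmorphM /= !rnormE; apply: H.
by rewrite -(RRe_real mr) ltcR; have := ler_norm (complex.Re m); lra.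
Qed.
End Distance.

(** * Maximal chains of invariant subspaces *)

Section Chains.
Variables (R : realType) (X : completeNormedModType R[i]).
Variables A B : {linear X -> X}.

Definition invariant_chain (C : set (set X)) : Prop :=
  subspace_chain C /\
  forall M, C M -> invariant_subspace A M /\ invariant_subspace B M.

Lemma stableP (T : X -> X) M : invariant_subspace T M <-> stable M T.
Proof.
by split=> [h x Mx|h _ [x Mx <-]]; [apply: h; exists x|exact: h].
Qed.

(** Zorn's lemma; the last clause is what maximality says of a chain enlarged by
    the single subspace [L]. *)
Lemma maximal_invariant_chain : exists2 C, invariant_chain C &
  forall L, subspace L -> norm_closed L -> stable L A -> stable L B ->
    (forall K, C K -> K `<=` L \/ L `<=` K) -> C L.
Proof.
have [|C [[[Cc Ct] Ci] maxC]] := @Zorn_bigcup (set X) invariant_chain.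
  move=> F FP tF; split; last by move=> M [D FD]; exact: (FP _ FD).2.
  split; first by move=> M [D FD]; exact: (FP _ FD).1.1.
  move=> K L [D FD DK] [E FE EL].
  have [DE|ED] := tF D E FD FE.
    by apply: (FP _ FE).1.2 => //; exact: DE.
  by apply: (FP _ FD).1.2 => //; exact: ED.
exists C => [//|L sL cL LA LB cmp]; apply: contrapT => nCL.
apply: (maxC (C `|` [set L])).
  by split; [exact: subsetUl|move=> h; apply: nCL; apply: h; right].
split; last first.
  by move=> M [/Ci//|->]; split; exact/stableP.
split; first by move=> M [/Cc//|->]; exact/closed_subspaceP.
move=> K K' [CK|->] [CK'|->]; [exact: Ct|exact: cmp| |by left].
by case: (cmp _ CK'); [right|left].
Qed.

Hypotheses (bA : bounded_operator A) (bB : bounded_operator B).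
Hypotheses (pcA : polynomially_compact A) (pcB : polynomially_compact B).
Hypothesis AAB : forall x, A (A (B x)) = A (B (A x)).
Hypothesis ABB : forall x, A (B (B x)) = B (A (B x)).

(** Enclose a member [L] of a larger chain between the closed span [N] of the
    members below it and the intersection [M] of those above it.  By maximality
    the pair is irreducible modulo [N] on [M], hence acts there by scalars, so
    [L] is itself invariant. *)
Lemma simultaneously_triangularizable_of_central_product :
  simultaneously_triangularizable A B.
Proof.
have [C [[Cc Ct] Ci] maxC] := maximal_invariant_chain.
exists C => //; split => // D [Dc Dt] CD L DL.
have Csub K : C K -> subspace K /\ norm_closed K by move=> /Cc/closed_subspaceP.
have CA K : C K -> stable K A by move=> /Ci[/stableP].
have CB K : C K -> stable K B by move=> /Ci[_ /stableP].
have [sL cL] : subspace L /\ norm_closed L by apply/closed_subspaceP/Dc.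
have cmpL K : C K -> K `<=` L \/ L `<=` K by move=> /CD DK; exact: Dt.
have [a0 a00 hA] := rnorm_bounded bA; have [b0 b00 hB] := rnorm_bounded bB.
have C0 : C [set 0].
  apply: maxC.
  - by split => // a x y -> ->; rewrite scaler0 addr0.
  - move=> x near; apply: rnorm_eq0; apply/eqP; rewrite eq_le rnorm_ge0 andbT.
    apply/ler_addgt0Pr => e e0; have [y -> h] := near e e0.
    by rewrite add0r -[x]subr0 ltW.
  - by move=> x ->; exact: linear0.
  - by move=> x ->; exact: linear0.
  - by move=> K CK; right => x ->; exact: (subspace0 (Csub K CK).1).
pose N : set X := [set x | forall e : R, 0 < e -> exists y, rnorm (x - y) < e /\
  exists K, [/\ C K, K `<=` L & K y]].
pose M : set X := [set x | forall K, C K -> L `<=` K -> K x].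
have KN K : C K -> K `<=` L -> K `<=` N.
  by move=> CK KL x Kx e e0; exists x; split; [rewrite subrr rnorm0|exists K].
have NL : N `<=` L.
  by move=> x Nx; apply: cL => e /Nx[y [h [K [_ KL Ky]]]]; exists y => //; exact: KL.
have LM : L `<=` M by move=> x Lx K _; apply.
have NM : N `<=` M by move=> x /NL/LM.
have cN : norm_closed N.
  move=> x near e e0; have e2 : 0 < e / 2 by lra.
  have [y Ny xy] := near _ e2; have [z [yz Kz]] := Ny _ e2.
  exists z; split => //; rewrite -(subrK y x) -addrA.
  by apply: le_lt_trans (rnormD _ _) _; lra.
have sN : subspace N.
  split; first by apply: (KN _ C0) => // x ->; exact: subspace0.
  move=> a x y Nx Ny e e0; have e2 : 0 < e / 2 by lra.
  have a1 : 0 < rnorm a + 1 by have := rnorm_ge0 a; lra.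
  have [u [xu [K [CK KL Ku]]]] := Nx _ (divr_gt0 e2 a1).
  have [v [yv [K' [CK' KL' Kv]]]] := Ny _ e2.
  exists (a *: u + v); split.
    rewrite opprD addrACA -scalerBr; apply: le_lt_trans (rnormD _ _) _.
    rewrite rnormZ; move: xu; rewrite ltr_pdivlMr // => xu.
    by have := rnorm_ge0 (x - u); lra.
  have [KK'|K'K] := Ct K K' CK CK'.
    by exists K'; split => //; apply: (subspaceP (Csub K' CK').1) => //; exact: KK'.
  by exists K; split => //; apply: (subspaceP (Csub K CK).1) => //; exact: K'K.
have stN (T : {linear X -> X}) c : 0 <= c -> (forall x, rnorm (T x) <= c * rnorm x) ->
    (forall K, C K -> stable K T) -> stable N T.
  move=> c0 hT CT x Nx e e0; have c1 : 0 < c + 1 by lra.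
  have [y [xy [K [CK KL Ky]]]] := Nx _ (divr_gt0 e0 c1).
  exists (T y); split; last by exists K; split => //; exact: CT.
  rewrite -linearB; apply: le_lt_trans (hT _) _.
  move: xy; rewrite ltr_pdivlMr // => xy.
  by have := rnorm_ge0 (x - y); lra.
have NA := stN A a0 a00 hA CA; have NB := stN B b0 b00 hB CB.
have sM : subspace M.
  split; first by move=> K CK _; exact: (subspace0 (Csub K CK).1).
  move=> a x y Mx My K CK LK.
  by apply: (subspaceP (Csub K CK).1); [exact: Mx|exact: My].
have cM : norm_closed M.
  move=> x near K CK LK; apply: (Csub K CK).2 => e /near[y My h].
  by exists y => //; exact: My.
have MA : stable M A by move=> x Mx K CK LK; apply: CA => //; exact: Mx.
have MB : stable M B by move=> x Mx K CK LK; apply: CB => //; exact: Mx.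
pose p := subspace_dist N.
have snp : seminorm p by exact: subspace_dist_seminorm.
have irr : irreducible_pair p M A B.
  move=> L' sL' L'M cL' L'A L'B [x L'x x0].
  have NL' : N `<=` L'.
    move=> y Ny; apply: cL' => [|e e0]; first exact: NM.
    by exists 0; [exact: subspace0|rewrite subr0 /p subspace_dist0].
  have CL' : C L'.
    apply: maxC => //.
      move=> y near; apply: cL' => [|e e0].
        by apply: cM => e e0; have [z /L'M Mz h] := near e e0; exists z.
      have [z L'z h] := near e e0; exists z => //.
      by apply: le_lt_trans h; exact: subspace_dist_le_rnorm.
    move=> K CK; have [KL|LK] := cmpL K CK.
      by left; apply: subset_trans NL'; exact: KN.
    by right => y /L'M; apply.
  have [L'L|LL'] := Dt _ _ (CD _ CL') DL; last by move=> y; apply.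
  by case: x0; apply: subspace_dist0 => //; exact: KN L'x.
have [P P0 cP] := pcA; have [Q Q0 cQ] := pcB.
have [a [b scal]] : exists a b, forall x, M x ->
    p (A x - a *: x) = 0 /\ p (B x - b *: x) = 0.
  apply: (irreducible_pair_scalar snp sM _ _ MA MB irr AAB ABB P0 _ Q0).
  - exact: subspace_dist_bounded hA NA.
  - exact: subspace_dist_bounded hB NB.
  - by apply: subspace_dist_compact => //; exact: stable_polyop.
  - by apply: subspace_dist_compact => //; exact: stable_polyop.
have LT (T : {linear X -> X}) c : (forall x, M x -> p (T x - c *: x) = 0) -> stable L T.
  move=> h x Lx; rewrite -(subrK (c *: x) (T x)); apply: (subspaceD sL).
    by apply: NL; apply: subspace_dist_eq0 => //; exact: h (LM _ Lx).
  exact: subspaceZ.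
apply: maxC => //.
- by apply: (LT A a) => x /scal[].
- by apply: (LT B b) => x /scal[].
Qed.
End Chains.

Theorem theorem4p1 (R : realType) (X : completeNormedModType R[i])
    (A B : {linear X -> X})
    (bA : bounded_operator A) (bB : bounded_operator B)
    (pcA : polynomially_compact A) (pcB : polynomially_compact B)
    (A_comm : forall x : X, A (commutator A B x) = 0)
    (comm_B : forall x : X, commutator A B (B x) = 0) :
  simultaneously_triangularizable A B.
Proof.
apply: simultaneously_triangularizable_of_central_product => // x.
  by apply/eqP; rewrite -subr_eq0 -linearB; apply/eqP; exact: A_comm.
by apply/eqP; rewrite -subr_eq0; apply/eqP; exact: comm_B.
Qed.
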